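(* Let $w\in\mathcal{W}$ be a weight sequence. If $\dot w\asymp w$, then $E_w$ (with the quasi-norm $|\cdot|_w$) is a quasi-Banach operator ideal in the sense of Pietsch.
   Context: $\mathbb{N}=\{1,2,\dots\}$. Hilbert spaces are complex and separable; $L(H_1,H_2)$ denotes the bounded operators from $H_1$ to $H_2$ with operator norm $\|\cdot\|$ and $S_\infty(H_1,H_2)$ the compact operators from $H_1$ to $H_2$. For compact $A$, $s_k(A)$ ($k\in\mathbb{N}$) is the $k$-th singular value, i.e. the square root of the $k$-th eigenvalue of $A^*A$ (decreasing order, with multiplicity, padded with zeros). $\mathcal{W}$ is the set of all $w:\mathbb{N}\to[0,\infty)$ with $w_k\ge w_{k+1}$ for all $k$ and $\lim_{k\to\infty}w_k=0$. For $w\in\mathcal W$, $E_w(H_1,H_2)$ is the set of all $A\in S_\infty(H_1,H_2)$ for which there is $M\ge0$ with $s_k(A)\le Mw_k$ for all $k\in\mathbb{N}$; the infimum of such $M$ is denoted $|A|_w$. $E_w$ denotes the family of all the classes $E_w(H_1,H_2)$, where $H_1,H_2$ are separable Hilbert spaces. Write $\dot w=(w_1,w_1,w_2,w_2,\dots)$. For $v,w\in\mathcal W$: $v\preceq w$ means there is $M\ge0$ with $v_k\le Mw_k$ for all $k\in\mathbb{N}$, and $v\asymp w$ means $v\preceq w$ and $w\preceq v$. A quasi-Banach operator ideal in the sense of Pietsch (here on separable Hilbert spaces) is a family of subsets $\mathfrak{A}(H_1,H_2)\subseteq L(H_1,H_2)$ with a function $\alpha:\mathfrak{A}\to[0,\infty)$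 such that: (0) the identity $I_{\mathbb{C}}$ of the one-dimensional space $\mathbb{C}$ belongs to $\mathfrak{A}$, with $\alpha(I_{\mathbb{C}})=1$; (1) each $\mathfrak{A}(H_1,H_2)$ is a linear space on which $\alpha$ is a quasi-norm, with $\alpha(A+B)\le M(\alpha(A)+\alpha(B))$ for a constant $M\ge1$ (independent of the spaces); (2) if $B\in L(H_2,H_1)$, $A\in\mathfrak{A}(H_3,H_2)$ and $C\in L(H_4,H_3)$, then $BAC\in\mathfrak{A}(H_4,H_1)$ and $\alpha(BAC)\le\|B\|\,\alpha(A)\,\|C\|$; (3) each $\mathfrak{A}(H_1,H_2)$ is complete with respect to $\alpha$.
   Formalization: Since |I_C|_w = 1/w_1, condition (0) fails unless w_1 = 1 (and I_C is not in E_w if w = 0); proved: all of (0)-(3) for |.|_w if w_1 = 1, (0)-(3) for w_1|.|_w if w_1 > 0, and (1)-(3) for |.|_w for every w. *)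

(* Defs.v *)
From HB Require Import structures.
From mathcomp Require Import all_boot all_order all_algebra sesquilinear.
From mathcomp Require Import complex.
From mathcomp Require Import all_classical all_reals all_analysis.

Set Implicit Arguments.
Unset Strict Implicit.
Unset Printing Implicit Defensive.
Import Order.TTheory GRing.Theory Num.Theory.
Import numFieldNormedType.Exports.
Local Open Scope classical_set_scope.
Local Open Scope card_scope.
Local Open Scope ring_scope.
Local Open Scope complex_scope.

Section Complex_complete.
Variable R : realType.

Lemma complex_cauchy_cvg (F : set_system (R[i]^o)) :
  ProperFilter F -> cauchy F -> cvg F.
Proof.
move=> FF Fc.
have ball_ri (z z' : R[i]) (e : R) : `|z - z'| < e%:C ->
    `|complex.Re z - complex.Re z'| < e /\ `|complex.Im z - complex.Im z'| < e.
  move: z z' => [a b] [c d] /=; rewrite normc_def ltcR /= => h.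
  by split; apply: le_lt_trans h; rewrite -sqrtr_sqr ler_wsqrtr//
     ?lerDl ?lerDr sqr_ge0.
have coord (p : R[i] -> R) :
    (forall z z' (e : R), `|z - z'| < e%:C -> `|p z - p z'| < e) ->
    exists l, forall e : R, 0 < e -> \forall z \near F, `|l - p z| < e.
  move=> hp.
  have : cauchy (p @ F).
    apply/cauchy_ballP => e e0.
    have /cauchy_ballP/(_ e%:C) := Fc.
    rewrite ltcR => /(_ e0) [[A B] [/= FA FB] AB].
    exists (p @` A, p @` B).
      by split; [apply: filterS FA|apply: filterS FB] => z zA; exists z.
    by move=> [_ _] [/= [x Ax <-] [y By <-]]; apply/hp/(AB (x, y)).
  move=> /R_complete/cvg_ex[l /cvgrPdist_lt lP].
  by exists l => e /lP.
have [a aP] := coord (@complex.Re R) (fun z z' e h => proj1 (ball_ri z z' e h)).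
have [b bP] := coord (@complex.Im R) (fun z z' e h => proj2 (ball_ri z z' e h)).
apply/cvg_ex; exists (a +i* b : R[i]^o); apply/cvgrPdist_lt => e e0.
have [eI eR] : complex.Im e = 0 /\ 0 < complex.Re e.
  by move: e0; rewrite ltcE /= => /andP[/eqP -> ->].
have e2 : 0 < complex.Re e / 2 by rewrite divr_gt0.
near=> z.
have ha : `|a - complex.Re z| < complex.Re e / 2 by near: z; exact: aP.
have hb : `|b - complex.Im z| < complex.Re e / 2 by near: z; exact: bP.
rewrite [e]complexE eI mulr0 addr0.
have -> : a +i* b - z = (a - complex.Re z)%:C + 'i%C * (b - complex.Im z)%:C :> R[i].
  by rewrite [LHS]complexE; case: (z).
apply: le_lt_trans (ler_normD _ _) _.
rewrite normrM !normc_def /= !expr0n /= !expr1n !addr0 !add0r sqrtr1 mul1r !sqrtr_sqr.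
rewrite -raddfD ltcR.
by rewrite [ltRHS]splitr ltrD.
Unshelve. all: by end_near. Qed.

End Complex_complete.

(* R[i] as a complete normed space over itself. It is not declared canonical:
   the complete structure on regular types is already keyed to realType. *)
Definition complex_completeNormedModType (R : realType) :
    completeNormedModType R[i] :=
  HB.pack (R[i]^o) (Uniform_isComplete.Build (R[i]^o) (@complex_cauchy_cvg R)).

Section Complex_hilbert.
Variable R : realType.
Local Notation C := (complex_completeNormedModType R).

Definition mul_conj (x y : R[i]) : R[i] := x * Num.conj y.

Lemma mul_conj_bilinear : @bilinear_for _ C C _
  (GRing.Scale.Law.clone _ _ *%R _)
  (GRing.Scale.Law.clone _ _ (Num.conj \; *%R) _) mul_conj.
Proof.
split=> u a x y; rewrite /mul_conj; first by rewrite mulrDl -mulrA.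
by rewrite rmorphD rmorphM mulrDr mulrCA.
Qed.

Lemma mul_conj_herm (x y : C) :
  mul_conj x y = (-1) ^+ false * Num.conj (mul_conj y x).
Proof. by rewrite mul1r /mul_conj rmorphM /= conjCK mulrC. Qed.

Lemma mul_conj_normE (x : C) : mul_conj x x = `|x| ^+ 2.
Proof. by rewrite /mul_conj -normCK. Qed.

Lemma mul_conj_gt0 (x : C) : x != 0 -> 0 < mul_conj x x.
Proof. by move=> x0; rewrite mul_conj_normE exprn_gt0// normr_gt0. Qed.

Definition complex_dot : {dot C for Num.conj} :=
  HB.pack (mul_conj : C -> C -> R[i])
    (bilinear_isBilinear.Build _ C C _ _ _ _ mul_conj_bilinear)
    (isHermitianSesquilinear.Build _ C false Num.conj mul_conj mul_conj_herm)
    (isDotProduct.Build _ C mul_conj mul_conj_gt0).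

Lemma complex_separable : exists2 D : set C, countable D & dense D.
Proof.
pose q (p : rat * rat) : C := (ratr p.1 +i* ratr p.2 : R[i]).
exists (range q); first exact: (sub_countable (card_image_le _ _) (countableP _)).
move=> O [z Oz] /(_ z Oz) /nbhs_ballP[e /= e0 eO].
have [eI eR] : complex.Im e = 0 /\ 0 < complex.Re e.
  by move: e0; rewrite ltcE /= => /andP[/eqP -> ->].
have e2 : 0 < complex.Re e / 2 by rewrite divr_gt0.
have approx (a : R) : exists r : rat, `|a - ratr r| < complex.Re e / 2.
  have [|r] := @rat_in_itvoo _ (a - complex.Re e / 2) (a + complex.Re e / 2).
    by rewrite ltrBlDr -addrA ltrDl addr_gt0.
  by rewrite in_itv /= -ltr_distl => h; exists r; rewrite distrC.
have [r hr] := approx (complex.Re (z : R[i])).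
have [s hs] := approx (complex.Im (z : R[i])).
exists (q (r, s)); split; last by exists (r, s).
apply: eO; rewrite -ball_normE /ball_ /=.
rewrite [e]complexE eI mulr0 addr0.
have -> : (z - q (r, s) : R[i]) = (complex.Re (z : R[i]) - ratr r)%:C
    + 'i%C * (complex.Im (z : R[i]) - ratr s)%:C :> R[i].
  by rewrite [LHS]complexE; case: (z : R[i]).
apply: le_lt_trans (ler_normD _ _) _.
rewrite normrM !normc_def /= !expr0n /= !expr1n !addr0 !add0r sqrtr1 mul1r.
by rewrite !sqrtr_sqr -raddfD ltcR [ltRHS]splitr ltrD.
Qed.

End Complex_hilbert.

(* Following mathcomp's {dot _ for _}, the inner product is linear in its first
   argument and conjugate-linear in the second. Finite-dimensional spaces,
   including {0}, are allowed. *)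
Record hilbertSpace (R : realType) := HilbertSpace {
  hilbert_sort :> completeNormedModType R[i];
  inner : {dot hilbert_sort for Num.conj};
  inner_normE : forall x, inner x x = `|x| ^+ 2;
  hilbert_separable : exists2 D : set hilbert_sort, countable D & dense D
}.

Definition complex_hilbert (R : realType) : hilbertSpace R :=
  HilbertSpace (inner := complex_dot R) (@mul_conj_normE R)
    (complex_separable R).

(* The norm of a normed space over R[i] takes its values in R[i]; this is the
   same number as an element of R. *)
Definition rnorm (R : realType) (V : normedModType R[i]) (x : V) : R :=
  complex.Re `|x|.

Section Operators.
Variable R : realType.
Implicit Types H : hilbertSpace R.

Definition bounded_operator H1 H2 (A : H1 -> H2) : Prop :=
  linear A /\ exists M : R, forall x, rnorm (A x) <= M * rnorm x.

Definition opnorm H1 H2 (A : H1 -> H2) : R :=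
  sup [set rnorm (A x) | x in [set x | rnorm x <= 1]].

Definition compact_operator H1 H2 (A : H1 -> H2) : Prop :=
  linear A /\ precompact (A @` [set x | rnorm x <= 1]).

(* The unique B with <A x, y> = <x, B y>, which exists for every bounded A. *)
Definition adjoint H1 H2 (A : H1 -> H2) : H2 -> H1 :=
  get [set B : H2 -> H1 | forall x y, inner H2 (A x) y = inner H1 x (B y)].

Definition eigenspace H (T : H -> H) (lam : R) : set H :=
  [set x | T x = lam%:C *: x].

Definition has_dim H (V : set H) (n : nat) : Prop :=
  exists e : 'I_n -> H,
    (forall c : 'I_n -> R[i], \sum_i c i *: e i = 0 -> forall i, c i = 0) /\
    V = [set x | exists c : 'I_n -> R[i], x = \sum_i c i *: e i].

(* a lists the eigenvalues of T in decreasing order, each positive eigenvalue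
   being repeated according to its multiplicity, and is padded with zeros when
   there are only finitely many positive ones. For a compact positive T there
   is exactly one such sequence. *)
Definition eigenvalue_sequence H (T : H -> H) (a : nat -> R) : Prop :=
  [/\ nonincreasing_seq a, forall k, 0 <= a k &
      forall lam : R, 0 < lam -> exists n,
        has_dim (eigenspace T lam) n /\ [set k | a k = lam] #= `I_n].

(* Sequences indexed by {1, 2, ...} are represented as functions on nat with
   the index shifted by one: singular_value A k is s_{k+1}(A). *)
Definition singular_value H1 H2 (A : H1 -> H2) (k : nat) : R :=
  Num.sqrt (get (eigenvalue_sequence (adjoint A \o A)) k).

Definition weight (w : nat -> R) : Prop :=
  [/\ forall k, 0 <= w k, nonincreasing_seq w & w @ \oo --> (0 : R)].

Definition dot_weight (w : nat -> R) : nat -> R := fun k => w k./2.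

Definition dominated (v w : nat -> R) : Prop :=
  exists2 M : R, 0 <= M & forall k, v k <= M * w k.

Definition weight_equiv (v w : nat -> R) : Prop :=
  dominated v w /\ dominated w v.

Definition operator_family := forall H1 H2, set (H1 -> H2).
Definition operator_functional := forall H1 H2, (H1 -> H2) -> R.

Definition E_bounds (w : nat -> R) H1 H2 (A : H1 -> H2) : set R :=
  [set M | 0 <= M /\ forall k, singular_value A k <= M * w k].

Definition E_class (w : nat -> R) : operator_family := fun H1 H2 =>
  [set A | compact_operator A /\ E_bounds w A !=set0].

Definition E_norm (w : nat -> R) : operator_functional := fun H1 H2 A =>
  inf (E_bounds w A).

(* Pietsch's definition without the normalisation at the identity of the
   one-dimensional space. The constant M does not depend on the spaces. *)
Record unnormalised_quasi_Banach_ideal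
    (F : operator_family) (alpha : operator_functional) : Prop := {
  ideal_bounded : forall H1 H2 (A : H1 -> H2), F H1 H2 A -> bounded_operator A;
  ideal_norm_ge0 : forall H1 H2 (A : H1 -> H2), F H1 H2 A -> 0 <= alpha H1 H2 A;
  ideal_zero : forall H1 H2, F H1 H2 0;
  ideal_add : forall H1 H2 (A B : H1 -> H2),
    F H1 H2 A -> F H1 H2 B -> F H1 H2 (A + B);
  ideal_scale : forall H1 H2 (c : R[i]) (A : H1 -> H2),
    F H1 H2 A -> F H1 H2 (c *: A);
  ideal_norm_eq0 : forall H1 H2 (A : H1 -> H2),
    F H1 H2 A -> (alpha H1 H2 A = 0 <-> A = 0);
  ideal_norm_scale : forall H1 H2 (c : R[i]) (A : H1 -> H2),
    F H1 H2 A -> alpha H1 H2 (c *: A) = complex.Re `|c| * alpha H1 H2 A;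
  ideal_norm_add : exists2 M : R, 1 <= M &
    forall H1 H2 (A B : H1 -> H2), F H1 H2 A -> F H1 H2 B ->
      alpha H1 H2 (A + B) <= M * (alpha H1 H2 A + alpha H1 H2 B);
  ideal_comp : forall H1 H2 H3 H4
      (B : H2 -> H1) (A : H3 -> H2) (C : H4 -> H3),
    bounded_operator B -> F H3 H2 A -> bounded_operator C ->
    F H4 H1 (B \o A \o C) /\
    alpha H4 H1 (B \o A \o C) <= opnorm B * alpha H3 H2 A * opnorm C;
  ideal_complete : forall H1 H2 (A_ : nat -> H1 -> H2),
    (forall n, F H1 H2 (A_ n)) ->
    (forall e : R, 0 < e -> exists N, forall m n, (N <= m)%N -> (N <= n)%N ->
       alpha H1 H2 (A_ m - A_ n) < e) ->
    exists2 A, F H1 H2 A & alpha H1 H2 (A_ n - A) @[n --> \oo] --> (0 : R)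
}.

Record quasi_Banach_ideal
    (F : operator_family) (alpha : operator_functional) : Prop := {
  ideal_identity : F (complex_hilbert R) (complex_hilbert R) idfun;
  ideal_identity_norm : alpha (complex_hilbert R) (complex_hilbert R) idfun = 1;
  ideal_unnormalised :> unnormalised_quasi_Banach_ideal F alpha
}.

End Operators.

(* Main.v *)
Require Import Defs.
From mathcomp Require Import all_boot all_order all_algebra sesquilinear complex.
From mathcomp Require Import all_classical all_reals all_analysis.
From mathcomp Require Import ring lra finmap.
Import Order.TTheory GRing.Theory Num.Theory.
Import numFieldNormedType.Exports.
Set Implicit Arguments.
Unset Strict Implicit.
Unset Printing Implicit Defensive.
Local Open Scope classical_set_scope.
Local Open Scope card_scope.
Local Open Scope complex_scope.
Local Open Scope ring_scope.

(** Call A "(k, t)-small" if |A x| <= t |x| for all x in the common kernel of k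
    linear functionals ([gelfand_le A k t]). For a compact A and t >= 0 this
    holds iff the singular value with 0-based index k is at most t. One
    direction comes from the singular vectors e_0, e_1, ... built by maximising
    |A x| on the unit ball of the orthogonal complement of the earlier ones;
    the |A e_k|^2 are the eigenvalues of A* A. For the other, the k functionals
    have a nonzero common zero in the span of e_0, ..., e_k. Smallness is
    visibly subadditive in (k, t) and compatible with composition, so the ideal
    axioms follow; splitting k into two halves and using w_(k/2) <= K w_k gives
    the quasi-triangle inequality. *)

(** * Norms with values in R[i] *)

Section Norm.
Variable R : realType.
Implicit Types V : normedModType R[i].

(** Both [adjoint] and [singular_value] are chosen by [get], so nothing is known about them until a
    suitable object is exhibited. For adjoints this is the Riesz representation; for singular values
    an eigenvalue sequence with exact multiplicities must be produced and shown to be unique.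
    Smallness is what makes sums tractable: A and B have unrelated singular vectors, whereas the
    kernels of two families of functionals simply intersect. It also survives limits: at fixed k an
    error in operator norm costs no functional, so completeness reduces to letting this error tend
    to 0. Singular vectors are allowed to vanish, which lets finite rank and finite dimension follow
    the general case. *)

Definition cabs (z : R[i]) : R := complex.Re `|z|.

Lemma ge0_complexE (z : R[i]) : 0 <= z -> z = (complex.Re z)%:C%C.
Proof. by case: z => a b; rewrite lecE /= => /andP[/eqP -> _]. Qed.

Lemma rnormE V (x : V) : `|x| = (rnorm x)%:C%C.
Proof. exact: ge0_complexE. Qed.

Lemma cabsE (z : R[i]) : `|z| = (cabs z)%:C%C.
Proof. exact: ge0_complexE. Qed.

Lemma rnorm_ge0 V (x : V) : 0 <= rnorm x.
Proof. by rewrite -lecR -rnormE; exact: normr_ge0. Qed.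

Lemma cabs_ge0 (z : R[i]) : 0 <= cabs z.
Proof. by rewrite -lecR -cabsE; exact: normr_ge0. Qed.

Lemma rnorm0 V : rnorm (0 : V) = 0.
Proof. by rewrite /rnorm normr0. Qed.

Lemma rnorm_eq0 V (x : V) : rnorm x = 0 -> x = 0.
Proof. by move=> h; apply/normr0_eq0; rewrite rnormE h. Qed.

Lemma rnorm_gt0 V (x : V) : x != 0 -> 0 < rnorm x.
Proof. by move=> x0; rewrite -ltcR -rnormE normr_gt0. Qed.

Lemma rnormN V (x : V) : rnorm (- x) = rnorm x.
Proof. by rewrite /rnorm normrN. Qed.

Lemma rnorm_distC V (x y : V) : rnorm (x - y) = rnorm (y - x).
Proof. by rewrite /rnorm distrC. Qed.

Lemma rnormD V (x y : V) : rnorm (x + y) <= rnorm x + rnorm y.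
Proof. by rewrite -lecR rmorphD /= -!rnormE ler_normD. Qed.

Lemma rnorm_distD V (z x y : V) : rnorm (x - y) <= rnorm (x - z) + rnorm (z - y).
Proof. by rewrite -(subrKA z x); exact: rnormD. Qed.

Lemma rnormZ V (c : R[i]) (x : V) : rnorm (c *: x) = cabs c * rnorm x.
Proof.
by apply/(@complexI R); rewrite rmorphM /= -!rnormE -cabsE normrZ.
Qed.

Lemma cabsM (a b : R[i]) : cabs (a * b) = cabs a * cabs b.
Proof. by apply/(@complexI R); rewrite rmorphM /= -!cabsE normrM. Qed.

Lemma cabsD (a b : R[i]) : cabs (a + b) <= cabs a + cabs b.
Proof. by rewrite -lecR rmorphD /= -!cabsE ler_normD. Qed.

Lemma cabs_real (a : R) : cabs a%:C%C = `|a|.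
Proof. by rewrite /cabs normc_def /= expr0n /= addr0 sqrtr_sqr. Qed.

Lemma cabs_eq0 (z : R[i]) : cabs z = 0 -> z = 0.
Proof. by move=> h; apply/normr0_eq0; rewrite cabsE h. Qed.

Lemma cabsN (z : R[i]) : cabs (- z) = cabs z.
Proof. by rewrite /cabs normrN. Qed.

Lemma cabs_conj (z : R[i]) : cabs (Num.conj z) = cabs z.
Proof. by rewrite /cabs norm_conjC. Qed.

Lemma cabs_sqr (z : R[i]) : (cabs z ^+ 2)%:C%C = z * Num.conj z.
Proof. by rewrite rmorphXn /= -cabsE normCK. Qed.

Lemma Re_le_cabs (z : R[i]) : `|complex.Re z| <= cabs z.
Proof.
by rewrite /cabs normc_def /= -sqrtr_sqr ler_wsqrtr // lerDl sqr_ge0.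
Qed.

Lemma Re_realM (a : R) (z : R[i]) : complex.Re (a%:C%C * z) = a * complex.Re z.
Proof. by case: z => x y /=; rewrite mul0r subr0. Qed.

Lemma complex_Re_conj (z : R[i]) : complex.Re (Num.conj z : R[i]) = complex.Re z.
Proof. by case: z. Qed.

Lemma conj_real (a : R) : Num.conj a%:C%C = a%:C%C.
Proof. exact: conjc_real. Qed.

(** Balls have their radii in [R[i]], where a positive element is real; real radii therefore
    describe the same topology. *)
Lemma nbhs_rnormP V (x : V) (A : set V) :
  nbhs x A <-> exists2 e : R, 0 < e & [set y | rnorm (x - y) < e] `<=` A.
Proof.
rewrite -nbhs_ballE; split => [[e /= e0 eA]|[e e0 eA]].
  have eE := ge0_complexE (ltW e0).
  exists (complex.Re e); first by rewrite -ltcR -eE.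
  by move=> y /= xy; apply: eA; rewrite -ball_normE /ball_ /= rnormE eE ltcR.
exists e%:C%C; first by rewrite /= ltcR.
move=> y; rewrite -ball_normE /ball_ /= rnormE ltcR; exact: eA.
Qed.

Lemma rnorm_complete (V : completeNormedModType R[i]) (u : nat -> V) :
  (forall e : R, 0 < e -> exists N, forall m n, (N <= m)%N -> (N <= n)%N ->
     rnorm (u m - u n) < e) ->
  exists l, forall e : R, 0 < e -> exists N, forall n, (N <= n)%N ->
     rnorm (u n - l) < e.
Proof.
move=> hu.
have : cvg (u @ \oo).
  apply/cauchy_cvgP/cauchy_ballP => e e0.
  have eE := ge0_complexE (ltW e0).
  have [|N hN] := hu (complex.Re e); first by rewrite -ltcR -eE.
  exists (u @` [set n | (N <= n)%N], u @` [set n | (N <= n)%N]).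
    by split; exists N => // n Nn; exists n.
  move=> [_ _] [/= [m Nm <-] [n Nn <-]].
  by rewrite -ball_normE /ball_ /= rnormE eE ltcR; exact: hN.
move=> /cvg_ex[l ul]; exists l => e e0.
have /ul [N _ hN] : nbhs l [set y | rnorm (l - y) < e].
  by apply/nbhs_rnormP; exists e.
by exists N => n Nn; rewrite rnorm_distC; exact: hN.
Qed.

Lemma small_le0 (r C : R) : (forall e : R, 0 < e -> r <= C * e) -> r <= 0.
Proof.
move=> h; apply/ler_addgt0Pr => e e0; rewrite add0r.
have C0 : 0 < `|C| + 1 by rewrite ltr_wpDl.
have := h (e / (`|C| + 1)) (divr_gt0 e0 C0) => /le_trans; apply.
by rewrite mulrCA ger_pMr // ler_pdivrMr // mul1r (le_trans (ler_norm _)) // lerDl.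
Qed.

Lemma natSinv_small (e : R) : 0 < e ->
  exists N, forall n, (N <= n)%N -> n.+1%:R^-1 < e.
Proof.
by move=> e0; have [N _ hN] := near_infty_natSinv_lt (PosNum e0); exists N.
Qed.

End Norm.

(** * Inner products and the Riesz representation *)

Section Inner.
Variables (R : realType) (H : hilbertSpace R).
Implicit Types x y z : H.
Local Notation "'[ x , y ]" := (inner H x y) : ring_scope.

Lemma innerC x y : '[x, y] = Num.conj '[y, x].
Proof. by rewrite (hermC (inner H)) expr0 mul1r. Qed.

Lemma innerDl x y z : '[x + y, z] = '[x, z] + '[y, z].
Proof. exact: linearDl. Qed.

Lemma innerDr x y z : '[z, x + y] = '[z, x] + '[z, y].
Proof. exact: linearDr. Qed.

Lemma innerBl x y z : '[x - y, z] = '[x, z] - '[y, z].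
Proof. exact: linearBl. Qed.

Lemma innerBr x y z : '[z, x - y] = '[z, x] - '[z, y].
Proof. exact: linearBr. Qed.

Lemma innerZl c x y : '[c *: x, y] = c * '[x, y].
Proof. exact: linearZl_LR. Qed.

Lemma innerZr c x y : '[x, c *: y] = Num.conj c * '[x, y].
Proof. exact: linearZr_LR. Qed.

Lemma inner0l x : '[0, x] = 0.
Proof. exact: linear0l. Qed.

Lemma inner0r x : '[x, 0] = 0.
Proof. exact: linear0r. Qed.

Lemma inner_suml (I : Type) (r : seq I) (P : pred I) (F : I -> H) y :
  '[\sum_(i <- r | P i) F i, y] = \sum_(i <- r | P i) '[F i, y].
Proof. by elim/big_rec2: _ => [|i a b _ <-]; rewrite ?inner0l ?innerDl. Qed.

Lemma innerxx x : '[x, x] = (rnorm x ^+ 2)%:C%C.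
Proof. by rewrite inner_normE rnormE rmorphXn. Qed.

Lemma rnormD_sqr x y :
  rnorm (x + y) ^+ 2 = rnorm x ^+ 2 + rnorm y ^+ 2 + 2 * complex.Re '[x, y].
Proof.
have E z : rnorm z ^+ 2 = complex.Re '[z, z] by rewrite innerxx.
rewrite !E innerDl !innerDr (innerC y x); case: '[x, y] '[x, x] '[y, y].
by move=> a b [a1 b1] [a2 b2] /=; ring.
Qed.

Lemma rnormB_sqr x y :
  rnorm (x - y) ^+ 2 = rnorm x ^+ 2 + rnorm y ^+ 2 - 2 * complex.Re '[x, y].
Proof.
rewrite rnormD_sqr rnormN -mulrN -scaleN1r innerZr rmorphN rmorph1 mulN1r.
by case: '[x, y].
Qed.

Lemma cauchy_schwarz x y : cabs '[x, y] <= rnorm x * rnorm y.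
Proof.
have [->|y0] := eqVneq y 0.
  by rewrite inner0r /cabs normr0 rnorm0 mulr0.
have ny := rnorm_gt0 y0; set d := '[x, y].
rewrite -(ler_pXn2r (n := 2)) ?nnegrE ?cabs_ge0 ?mulr_ge0 ?rnorm_ge0 //.
have : 0 <= rnorm ((rnorm y ^+ 2)%:C%C *: x - d *: y) ^+ 2 by rewrite sqr_ge0.
rewrite rnormB_sqr !rnormZ innerZl innerZr -/d [Num.conj d * d]mulrC.
rewrite -cabs_sqr !Re_realM /= cabs_real ger0_norm ?sqr_ge0 // => h.
rewrite -(ler_pM2l (exprn_gt0 2 ny)) -subr_ge0 (le_trans h) //.
by rewrite le_eqVlt; apply/orP; left; apply/eqP; ring.
Qed.

Lemma Re_inner_le x y : `|complex.Re '[x, y]| <= rnorm x * rnorm y.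
Proof. exact: le_trans (Re_le_cabs _) (cauchy_schwarz x y). Qed.

Lemma inner_inj x y : (forall z, '[z, x] = '[z, y]) -> x = y.
Proof.
move=> h; apply/eqP; rewrite -subr_eq0; apply/eqP/rnorm_eq0/eqP.
by rewrite -sqrf_eq0; apply/eqP/(@complexI R); rewrite -innerxx innerBr h subrr.
Qed.

End Inner.

Section Riesz.
Variables (R : realType) (H : hilbertSpace R).
Variables (f : H -> R[i]) (M : R).
Hypothesis f_lin : forall a x y, f (a *: x + y) = a * f x + f y.
Hypothesis f_bnd : forall x, cabs (f x) <= M * rnorm x.

(** If f = <., y> then J x = |x - y|^2 - |y|^2, so the representing vector is the minimiser of this
    energy. *)
Let J (x : H) : R := rnorm x ^+ 2 - 2 * complex.Re (f x).

Lemma riesz_energy_ge x : - M ^+ 2 <= J x.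
Proof.
have h := le_trans (ler_norm _) (le_trans (Re_le_cabs (f x)) (f_bnd x)).
have := sqr_ge0 (rnorm x - M); rewrite /J; nra.
Qed.

Let d := inf (range J).

Lemma riesz_inf_le x : d <= J x.
Proof.
by apply: ge_inf; [exists (- M ^+ 2) => _ [y _ <-]; exact: riesz_energy_ge|exists x].
Qed.

Lemma riesz_minseq : exists u : nat -> H, forall n, J (u n) < d + n.+1%:R^-1.
Proof.
suff /choice[u hu] : forall n, exists x, J x < d + n.+1%:R^-1 by exists u.
move=> n; have hJ : has_inf (range J).
  split; first by exists (J 0), 0.
  by exists (- M ^+ 2) => _ [y _ <-]; exact: riesz_energy_ge.
have e0 : 0 < n.+1%:R^-1 :> R by rewrite invr_gt0.
by have [_ [x _ <-] h] := inf_adherent e0 hJ; exists x.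
Qed.

(** The linear parts cancel in 2 (J x + J y) - 4 J ((x + y) / 2) = |x - y|^2, and J is at least d at
    the midpoint. Hence minimising sequences are Cauchy. *)
Lemma riesz_parallelogram x y : rnorm (x - y) ^+ 2 <= 2 * (J x + J y) - 4 * d.
Proof.
have := riesz_inf_le ((1 / 2)%:C%C *: (x + y)).
have f0 : f 0 = 0 by have := f_lin (-1) 0 0; rewrite scaler0 addr0 mulN1r addNr.
rewrite {1}/J rnormZ cabs_real -[in f _](addr0 (_ *: (x + y))) f_lin f0 addr0.
rewrite Re_realM -[in f _](scale1r x) f_lin !mul1r ger0_norm ?divr_ge0 //.
rewrite rnormB_sqr exprMn rnormD_sqr /J raddfD /=.
lra.
Qed.

(* Comparing an almost minimiser y with y - s conj(g) x, where
   g = <x, y> - f x and s = 1 / (|x|^2 + 1), bounds g. *)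
Lemma riesz_residual (e : R) x y : J y <= d + e ->
  cabs (inner H x y - f x) ^+ 2 <= e * (rnorm x ^+ 2 + 1).
Proof.
set g := _ - _ => hy.
set s : R := (rnorm x ^+ 2 + 1)^-1.
have D0 : 0 < rnorm x ^+ 2 + 1 by rewrite ltr_wpDl ?sqr_ge0.
have s0 : 0 < s by rewrite invr_gt0.
have := riesz_inf_le ((- (s%:C%C * Num.conj g)) *: x + y).
rewrite {1}/J f_lin rnormD_sqr rnormZ innerZl [complex.Re (_ * f x + _)]raddfD /=.
rewrite cabsN cabsM cabs_conj cabs_real (gtr0_norm s0).
have E : complex.Re (- (s%:C%C * Num.conj g) * inner H x y)
    - complex.Re (- (s%:C%C * Num.conj g) * f x) = - (s * cabs g ^+ 2).
  rewrite -raddfB /= -mulrBr -/g mulNr raddfN /= -mulrA Re_realM.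
  by rewrite [Num.conj g * g]mulrC -cabs_sqr.
move=> h.
(* At the perturbed vector J equals J y - 2 s |g|^2 + s^2 |g|^2 |x|^2, so this bound makes it at
   most J y - s |g|^2, while it is at least d. *)
have sx : s * rnorm x ^+ 2 <= 1.
  by rewrite /s mulrC ler_pdivrMr // mul1r lerDl.
rewrite -ler_pdivrMr // -/s.
have c0 := sqr_ge0 (cabs g).
have key : s * (cabs g ^+ 2 * (s * rnorm x ^+ 2)) <= s * (cabs g ^+ 2 * 1).
  by rewrite ler_pM2l // ler_wpM2l.
move: h hy E key; rewrite /J !exprMn -/s; set p := complex.Re (_ * inner _ _ _).
set q := complex.Re (_ * f x); set c2 := cabs g ^+ 2; set X := rnorm x ^+ 2.
move=> h hy E key.
have : s ^+ 2 * c2 * X <= s * c2 by rewrite expr2; nra.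
lra.
Qed.

Lemma riesz : exists y, forall x, f x = inner H x y.
Proof.
have [u hu] := riesz_minseq.
have [|y hy] := @rnorm_complete R H u.
  move=> e e0.
  (* The parallelogram bound gives |u m - u n|^2 <= 2 (1/(m+1) + 1/(n+1)), whence the 4. *)
  have [N hN] : exists N, forall n, (N <= n)%N -> n.+1%:R^-1 < e ^+ 2 / 4.
    by apply: natSinv_small; rewrite divr_gt0 // exprn_gt0.
  exists N => m n Nm Nn.
  rewrite -(ltr_pXn2r (n := 2)) ?nnegrE ?rnorm_ge0 ?(ltW e0) //.
  apply: le_lt_trans (riesz_parallelogram _ _) _.
  move: (hu m) (hu n) (hN m Nm) (hN n Nn).
  by set p := m.+1%:R^-1; set q := n.+1%:R^-1; lra.
exists y => x; apply/esym/eqP; rewrite -subr_eq0; apply/eqP/cabs_eq0/eqP.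
rewrite eq_le cabs_ge0 andbT; apply/ler_addgt0Pr => e e0; rewrite add0r.
set X := rnorm x; have X0 : 0 <= X := rnorm_ge0 x.
have D0 : 0 < X ^+ 2 + 1 by rewrite ltr_wpDl ?sqr_ge0.
have D1 : 0 < X + 1 by rewrite ltr_wpDl.
have [N1 h1] : exists N, forall n, (N <= n)%N ->
    n.+1%:R^-1 < (e / 2) ^+ 2 / (X ^+ 2 + 1).
  by apply: natSinv_small; rewrite divr_gt0 // exprn_gt0 // divr_gt0.
have [N2 h2] := hy (e / 2 / (X + 1)) ltac:(by rewrite !divr_gt0).
pose n := maxn N1 N2.
have {h1} := h1 n (leq_maxl _ _); have {h2} := h2 n (leq_maxr _ _).
rewrite !ltr_pdivlMr // => h2 h1.
have -> : inner H x y - f x = (inner H x (u n) - f x) + inner H x (y - u n).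
  by rewrite innerBr; ring.
apply: le_trans (cabsD _ _) _; rewrite [leRHS]splitr lerD //.
  rewrite -(ler_pXn2r (n := 2)) ?nnegrE ?cabs_ge0 ?divr_ge0 ?(ltW e0) //.
  exact: le_trans (riesz_residual x (ltW (hu n))) (ltW h1).
apply: le_trans (cauchy_schwarz _ _) _; rewrite rnorm_distC -/X mulrC.
rewrite ler_pdivlMr // (le_trans _ (ltW h2)) // ler_wpM2r //.
by rewrite ler_wpM2l ?rnorm_ge0 // lerDl.
Qed.

End Riesz.

(** * Total boundedness and adjoints *)

Section TotallyBounded.
Variable R : realType.

(** Finite nets pass easily through sums, Lipschitz images and uniform limits; the equivalence with
    precompactness transfers this to compact operators. The centres need not lie in S. *)
Definition totally_bounded (V : normedModType R[i]) (S : set V) : Prop :=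
  forall e : R, 0 < e -> exists s : seq V,
    forall x, S x -> exists2 y, y \in s & rnorm (x - y) < e.

Lemma precompact_totally_bounded (V : normedModType R[i]) (S : set V) :
  precompact S -> totally_bounded S.
Proof.
rewrite precompactE compact_cover => cS e e0.
have [x _||D _ hD] := cS V setT (fun x => interior [set y | rnorm (x - y) < e]).
- exact: open_interior.
- by move=> x _; exists x => //; apply/nbhs_rnormP; exists e.
exists (finmap.enum_fset D) => x /subset_closure /hD [y /= yD xy].
by exists y => //; rewrite rnorm_distC; exact: (interior_subset xy).
Qed.

Lemma ultra_seq_cover (T : choiceType) (F : set_system T) (s : seq T)
    (f : T -> set T) : UltraFilter F ->
  F [set x | exists2 y, y \in s & f y x] -> exists y, F (f y).
Proof.
move=> UF; elim: s => [|y s IH] Fs.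
  by have [x [y]] := filter_ex Fs.
have [Fy|/(filterI Fs) Fs'] := in_ultra_setVsetC (f y) UF; first by exists y.
apply: IH; apply: filterS Fs' => x [[z + fz] nfy].
by rewrite inE => /orP[/eqP zy|zs]; [rewrite zy in fz|exists z].
Qed.

(** An ultrafilter containing a finite union contains one of its members, so an ultrafilter on the
    closure of S contains arbitrarily small balls. It is therefore Cauchy and converges. *)
Lemma totally_bounded_precompact (V : completeNormedModType R[i]) (S : set V) :
  totally_bounded S -> precompact S.
Proof.
move=> tS; rewrite precompactE compact_ultra /= => F UF FS.
have : cvg F.
  apply/cauchy_cvgP/cauchy_ballP => e e0.
  have eE := ge0_complexE (ltW e0).
  (* One quarter is spent on passing from the closure to S, one on the net; two points of a ball of
     radius e/2 are then within e. *)
  have e4 : 0 < complex.Re e / 4 by rewrite divr_gt0 // -ltcR -eE.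
  have [s hs] := tS _ e4.
  have [y Fy] : exists y : V, F [set x | rnorm (x - y) < complex.Re e / 2].
    apply: (@ultra_seq_cover V F s
      (fun y => [set x | rnorm (x - y) < complex.Re e / 2])).
    apply: filterS FS => x Sx.
    have [|z [Sz /= xz]] := Sx [set z | rnorm (x - z) < complex.Re e / 4].
      by apply/nbhs_rnormP; exists (complex.Re e / 4).
    have [y ys zy] := hs z Sz; exists y => //=.
    by have := rnorm_distD z x y; lra.
  exists ([set x | rnorm (x - y) < complex.Re e / 2],
          [set x | rnorm (x - y) < complex.Re e / 2]) => //.
  move=> [a b] [/= ha hb]; rewrite -ball_normE /ball_ /= rnormE eE ltcR.
  by have := rnorm_distD y a b; rewrite [rnorm (y - b)]rnorm_distC; lra.
move=> /cvg_ex[l Fl]; exists l; split => //.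
apply: closed_closure => B /Fl FB.
exact: (filter_ex (filterI FS FB)).
Qed.

(** z is a cluster point of u. [phi] is not made increasing: j <= [phi j] suffices to reach
    arbitrarily late indices. *)
Lemma precompact_subseq (V : normedModType R[i]) (S : set V) (u : nat -> V) :
  precompact S -> (forall n, S (u n)) ->
  exists z (phi : nat -> nat), forall j,
    (j <= phi j)%N /\ rnorm (u (phi j) - z) < j.+1%:R^-1.
Proof.
rewrite precompactE => cS uS.
have [|z [_ hz]] := cS (u @ \oo) _.
  by exists 0%N => // n _; exact/subset_closure/uS.
exists z; suff /choice[phi hphi] : forall j, exists n,
    (j <= n)%N /\ rnorm (u n - z) < j.+1%:R^-1 by exists phi.
move=> j.
have [||n [/= [m /= jm <-]]] :=
    hz (u @` [set m | (j <= m)%N]) [set x | rnorm (z - x) < j.+1%:R^-1].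
- by exists j => // m jm; exists m.
- by apply/nbhs_rnormP; exists j.+1%:R^-1 => //; rewrite invr_gt0.
by rewrite rnorm_distC => h; exists m.
Qed.

Lemma totally_bounded_bound (V : normedModType R[i]) (S : set V) :
  totally_bounded S -> exists2 M : R, 0 <= M & forall x, S x -> rnorm x <= M.
Proof.
move=> /(_ 1 ltr01) [s hs]; exists (1 + \sum_(y <- s) rnorm y).
  by rewrite addr_ge0 // sumr_ge0 // => y _; exact: rnorm_ge0.
move=> x /hs[y ys xy].
have : rnorm y <= \sum_(y <- s) rnorm y.
  rewrite (big_rem y) //= lerDl sumr_ge0 // => z _; exact: rnorm_ge0.
have := rnormD (x - y) y; rewrite subrK; lra.
Qed.

End TotallyBounded.

Section Bounded.
Variable R : realType.
Implicit Types H : hilbertSpace R.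

Definition unit_ball H : set H := [set x | rnorm x <= 1].

Section Linear.
Variables (H1 H2 : hilbertSpace R) (A : H1 -> H2).
Hypothesis A_lin : linear A.

Lemma lin0 : A 0 = 0.
Proof. by have := A_lin (-1) 0 0; rewrite scaler0 addr0 scaleN1r addNr. Qed.

Lemma linD x y : A (x + y) = A x + A y.
Proof. by have := A_lin 1 x y; rewrite !scale1r. Qed.

Lemma linZ c x : A (c *: x) = c *: A x.
Proof. by have := A_lin c x 0; rewrite lin0 !addr0. Qed.

Lemma linB x y : A (x - y) = A x - A y.
Proof. by rewrite -scaleN1r linD linZ scaleN1r. Qed.

Lemma lin_sum (I : Type) (r : seq I) (P : pred I) (F : I -> H1) :
  A (\sum_(i <- r | P i) F i) = \sum_(i <- r | P i) A (F i).
Proof. by elim/big_rec2: _ => [|i a b _ <-]; rewrite ?lin0 ?linD. Qed.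

(** Serves for operator norms, with V the whole space, and for the norm of A on an orthogonal
    complement. *)
Lemma unit_ball_bound (V : set H1) (M : R) :
  (forall (c : R) x, V x -> V (c%:C%C *: x)) ->
  (forall x, V x -> rnorm x <= 1 -> rnorm (A x) <= M) ->
  forall x, V x -> rnorm (A x) <= M * rnorm x.
Proof.
move=> VZ h x Vx; have [->|x0] := eqVneq x 0; first by rewrite lin0 !rnorm0 mulr0.
have n0 := rnorm_gt0 x0.
have := h _ (VZ (rnorm x)^-1 x Vx).
rewrite linZ !rnormZ cabs_real gtr0_norm ?invr_gt0 // mulVf ?gt_eqF //.
by move=> /(_ (lexx _)); rewrite mulrC ler_pdivrMr.
Qed.

End Linear.

Lemma compact_operator_bound H1 H2 (A : H1 -> H2) : compact_operator A ->
  exists2 M : R, 0 <= M & forall x, rnorm (A x) <= M * rnorm x.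
Proof.
move=> [lA /precompact_totally_bounded/totally_bounded_bound[M M0 hM]].
exists M => // x; apply: (unit_ball_bound lA (V := setT)) => // y _ y1.
by apply: hM; exists y.
Qed.

Lemma compact_operator_bounded H1 H2 (A : H1 -> H2) :
  compact_operator A -> bounded_operator A.
Proof.
move=> cA; have [M _ hM] := compact_operator_bound cA.
by split; [exact: cA.1|exists M].
Qed.

Lemma opnorm_has_sup H1 H2 (A : H1 -> H2) : bounded_operator A ->
  has_sup [set rnorm (A x) | x in [set x | rnorm x <= 1]].
Proof.
move=> [lA [M hM]]; split; first by exists (rnorm (A 0)), 0; rewrite //= rnorm0.
exists `|M| => _ [x /= x1 <-]; apply: le_trans (hM x) _.
apply: le_trans (ler_norm _) _; rewrite normrM (ger0_norm (rnorm_ge0 x)).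
by rewrite ler_piMr.
Qed.

Lemma opnorm_ge0 H1 H2 (A : H1 -> H2) : bounded_operator A -> 0 <= opnorm A.
Proof.
move=> bA; apply: le_trans (rnorm_ge0 (A 0)) _; apply: sup_ubound.
  exact: (opnorm_has_sup bA).2.
by exists 0; rewrite //= rnorm0.
Qed.

Lemma opnorm_bound H1 H2 (A : H1 -> H2) : bounded_operator A ->
  forall x, rnorm (A x) <= opnorm A * rnorm x.
Proof.
move=> bA x; apply: (unit_ball_bound bA.1 (V := setT)) => // y _ y1.
by apply: sup_ubound; [exact: (opnorm_has_sup bA).2|exists y].
Qed.

(** [get] returns an adjoint as soon as one exists; its value at y is the vector representing the
    functional <A ., y>, which is bounded by [opnorm A * rnorm y]. *)
Lemma adjointP H1 H2 (A : H1 -> H2) : bounded_operator A ->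
  forall x y, inner H2 (A x) y = inner H1 x (adjoint A y).
Proof.
move=> bA; apply: (@getPex _ [set B : H2 -> H1 |
  forall x y, inner H2 (A x) y = inner H1 x (B y)]).
suff /choice[B hB] : forall y, exists z, forall x, inner H2 (A x) y = inner H1 x z.
  by exists B => x y.
move=> y; apply: (@riesz R H1 (fun x => inner H2 (A x) y) (opnorm A * rnorm y)).
  by move=> a u v; rewrite bA.1 innerDl innerZl.
move=> x; apply: le_trans (cauchy_schwarz _ _) _.
by rewrite mulrAC ler_wpM2r ?rnorm_ge0 // opnorm_bound.
Qed.

Lemma adjoint_linear H1 H2 (A : H1 -> H2) : bounded_operator A ->
  linear (adjoint A).
Proof.
move=> bA a u v; apply: inner_inj => z.
by rewrite innerDr innerZr -!adjointP // innerDr innerZr.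
Qed.

Lemma adjoint_bound H1 H2 (A : H1 -> H2) : bounded_operator A ->
  forall y, rnorm (adjoint A y) <= opnorm A * rnorm y.
Proof.
move=> bA y; set z := adjoint A y.
have [z0|/rnorm_gt0 z0] := eqVneq z 0.
  by rewrite z0 rnorm0 mulr_ge0 ?rnorm_ge0 ?opnorm_ge0.
rewrite -(ler_pM2r z0) -expr2.
have -> : rnorm z ^+ 2 = complex.Re (inner H2 (A z) y).
  by rewrite adjointP // -/z innerxx.
apply: le_trans (ler_norm _) _; apply: le_trans (Re_inner_le _ _) _.
by rewrite mulrAC ler_wpM2r ?rnorm_ge0 // opnorm_bound.
Qed.

End Bounded.

(** * Singular vectors *)

Section Singular_vectors.
Variables (R : realType) (H1 H2 : hilbertSpace R) (A : H1 -> H2).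
Hypothesis cA : compact_operator A.
Let lA : linear A := cA.1.
Let bA : bounded_operator A := compact_operator_bounded cA.
Let T : H1 -> H1 := adjoint A \o A.

Lemma inner_gram x y : inner H1 x (T y) = inner H2 (A x) (A y).
Proof. by rewrite adjointP. Qed.

Lemma Re_gram x : complex.Re (inner H1 (T x) x) = rnorm (A x) ^+ 2.
Proof. by rewrite innerC; rewrite complex_Re_conj inner_gram innerxx. Qed.

Lemma gram_linear : linear T.
Proof. by move=> a u v; rewrite /T /= lA adjoint_linear. Qed.

Definition perp (s : seq H1) : set H1 :=
  [set x | forall u, u \in s -> inner H1 x u = 0].

Definition gram_eigenvectors (s : seq H1) : Prop :=
  forall u, u \in s -> exists lam : R, T u = lam%:C%C *: u.

(** T is self-adjoint, so <T x, u> = <x, T u> is a multiple of <x, u> for each eigenvector u. *)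
Lemma perp_gram s x : gram_eigenvectors s -> perp s x -> perp s (T x).
Proof.
move=> hs hx u us; have [lam Tu] := hs u us.
rewrite innerC inner_gram -innerC -inner_gram Tu innerZr hx //.
by rewrite mulr0.
Qed.

(* Let m be the norm of A on the orthogonal complement of s. Along a maximising
   sequence T x_n - m^2 x_n tends to 0, so a limit point of T x_n divided by m^2
   is a limit point of x_n; no weak compactness is needed. *)
Lemma max_singular_vector s : gram_eigenvectors s ->
  exists e, [/\ perp s e, rnorm e <= 1,
    forall x, perp s x -> rnorm (A x) <= rnorm (A e) * rnorm x &
    T e = (rnorm (A e) ^+ 2)%:C%C *: e].
Proof.
move=> hs; pose V := perp s.
have V0 : V 0 by move=> u _; rewrite inner0l.
have VZ (c : R) x : V x -> V (c%:C%C *: x).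
  by move=> Vx u us; rewrite innerZl Vx // mulr0.
have [M M0 hM] := compact_operator_bound cA.
pose S := [set rnorm (A x) | x in [set x | V x /\ rnorm x <= 1]].
have S0 : S 0 by exists 0; rewrite /= ?(lin0 lA) ?rnorm0.
have hS : has_sup S.
  split; first by exists 0.
  exists M => _ [x [_ x1] <-]; apply: le_trans (hM x) _.
  by rewrite ler_piMr.
pose m := sup S.
have m0 : 0 <= m by apply: sup_ubound => //; exact: hS.2.
have hm x : V x -> rnorm (A x) <= m * rnorm x.
  move=> Vx; apply: (unit_ball_bound lA VZ) => // y Vy y1.
  by apply: sup_ubound; [exact: hS.2|exists y].
(* When A vanishes on the complement, e = 0 has all the required properties, so the construction of
   singular vectors never stops. *)
have [m_eq0|m_neq0] := eqVneq m 0.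
  exists 0; split => //; rewrite ?rnorm0 //.
    by move=> x /hm; rewrite m_eq0 lin0 // rnorm0.
  by rewrite scaler0 /T /= !lin0 //; exact: adjoint_linear.
have m_gt0 : 0 < m by rewrite lt_def m_neq0.
(* The square is |T x|^2 + m^4 |x|^2 - 2 m^2 |A x|^2 <= 2 m^2 (m - |A x|) (m + |A x|), and m + |A x|
   <= 2 m. *)
have defect x : V x -> rnorm x <= 1 ->
    rnorm (T x - (m ^+ 2)%:C%C *: x) ^+ 2 <= 4 * m ^+ 3 * (m - rnorm (A x)).
  move=> Vx x1; have VTx : V (T x) by exact: perp_gram.
  have hTx : rnorm (T x) <= m ^+ 2.
    have [->|/rnorm_gt0 Tx0] := eqVneq (T x) 0; first by rewrite rnorm0 sqr_ge0.
    rewrite -(ler_pM2r Tx0) -expr2.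
    have -> : rnorm (T x) ^+ 2 = complex.Re (inner H2 (A (T x)) (A x)).
      by rewrite -inner_gram innerxx.
    apply: le_trans (ler_norm _) _; apply: le_trans (Re_inner_le _ _) _.
    rewrite mulrC expr2 -mulrA ler_pM ?rnorm_ge0 //; last exact: hm.
    by apply: le_trans (hm _ Vx) _; rewrite ler_piMr.
  rewrite rnormB_sqr innerZr conj_real Re_realM Re_gram rnormZ cabs_real.
  rewrite ger0_norm ?sqr_ge0 //.
  have Ax : rnorm (A x) <= m by apply: le_trans (hm _ Vx) _; rewrite ler_piMr.
  have Ax0 := rnorm_ge0 (A x); have Tx0 := rnorm_ge0 (T x).
  have x0 := rnorm_ge0 x.
  have t1 : rnorm (T x) ^+ 2 <= m ^+ 2 ^+ 2 by rewrite ler_pXn2r ?nnegrE ?sqr_ge0.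
  have t2 : (m ^+ 2 * rnorm x) ^+ 2 <= m ^+ 2 ^+ 2.
    by rewrite ler_pXn2r ?nnegrE ?mulr_ge0 ?sqr_ge0 // ler_piMr ?sqr_ge0.
  have t3 : m ^+ 2 * ((m - rnorm (A x)) * (m + rnorm (A x))) <=
            m ^+ 2 * ((m - rnorm (A x)) * (2 * m)).
    by rewrite ler_wpM2l ?sqr_ge0 // ler_wpM2l ?subr_ge0 //; lra.
  move: t1 t2 t3; set a := rnorm (A x); set b := rnorm (T x) ^+ 2.
  set c := (_ * rnorm x) ^+ 2.
  have -> : m ^+ 2 * ((m - a) * (m + a)) = m ^+ 2 ^+ 2 - m ^+ 2 * a ^+ 2 by ring.
  have -> : m ^+ 2 * ((m - a) * (2 * m)) = 2 * m ^+ 3 * (m - a) by ring.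
  by lra.
have [u hu] : exists u : nat -> H1, forall n,
    [/\ V (u n), rnorm (u n) <= 1 & m - rnorm (A (u n)) < n.+1%:R^-1].
  suff /choice[u hu] : forall n, exists x,
    [/\ V x, rnorm x <= 1 & m - rnorm (A x) < n.+1%:R^-1] by exists u.
  move=> n; have e0 : 0 < n.+1%:R^-1 :> R by rewrite invr_gt0.
  have [_ [x [Vx x1] <-] h] := sup_adherent e0 hS.
  by exists x; split=> //; rewrite ltrBlDr -ltrBlDl.
have [z [phi hphi]] : exists z (phi : nat -> nat), forall j,
    (j <= phi j)%N /\ rnorm (A (u (phi j)) - z) < j.+1%:R^-1.
  apply: (precompact_subseq cA.2 (u := A \o u)) => n.
  by exists (u n) => //; case: (hu n).
pose e := (m ^- 2)%:C%C *: adjoint A z.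
have approx d : 0 < d -> exists x,
    [/\ V x, rnorm x <= 1, m - rnorm (A x) <= d & rnorm (e - x) <= d].
  move=> d0; pose K := opnorm A.
  have K0 : 0 <= K := opnorm_ge0 bA.
  have m2 : 0 < m ^+ 2 by rewrite exprn_gt0.
  have m3 : 0 < m ^+ 3 by rewrite exprn_gt0.
  have md0 : 0 < m ^+ 2 * d / 2 by rewrite divr_gt0 // mulr_gt0.
  have [N1 h1] := natSinv_small d0.
  (* In m^2 (e - x) = A* (z - A x) + (T x - m^2 x) each summand is to be at most m^2 d / 2: [h2]
     controls the first and [h3], through [defect], the second. *)
  have [N2 h2] := natSinv_small (e := m ^+ 2 * d / 2 / (K + 1))
    ltac:(by rewrite divr_gt0 // ltr_wpDl).
  have [N3 h3] := natSinv_small (e := (m ^+ 2 * d / 2) ^+ 2 / (4 * m ^+ 3))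
    ltac:(by rewrite divr_gt0 ?exprn_gt0 // mulr_gt0).
  pose j := maxn N1 (maxn N2 N3).
  have [jphi hj] := hphi j; have [Vx x1 hx] := hu (phi j).
  set x := u (phi j) in hj Vx x1 hx *.
  have le1 : (N1 <= j)%N by rewrite leq_maxl.
  have le2 : (N2 <= j)%N by rewrite leq_max leq_maxl orbT.
  have le3 : (N3 <= j)%N by rewrite !leq_max leqnn !orbT.
  have {}h1 := h1 _ (leq_trans le1 jphi); have {}h2 := h2 _ le2.
  have {}h3 := h3 _ (leq_trans le3 jphi).
  exists x; split => //; first by rewrite ltW // (lt_trans hx).
  rewrite -(ler_pM2l m2).
  have -> : m ^+ 2 * rnorm (e - x) =
      rnorm (adjoint A (z - A x) + (T x - (m ^+ 2)%:C%C *: x)).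
    rewrite (linB (adjoint_linear bA)) addrA subrK.
    have -> : adjoint A z = (m ^+ 2)%:C%C *: e.
      by rewrite scalerA -rmorphM /= mulfV ?gt_eqF // scale1r.
    by rewrite -scalerBr rnormZ cabs_real gtr0_norm.
  apply: le_trans (rnormD _ _) _; rewrite [leRHS]splitr lerD //.
    apply: le_trans (adjoint_bound bA _) _; rewrite rnorm_distC.
    apply: le_trans (_ : (K + 1) * j.+1%:R^-1 <= _).
      by rewrite ler_pM ?rnorm_ge0 ?lerDl // ltW.
    by rewrite mulrC -ler_pdivlMr ?ltr_wpDl // ltW.
  rewrite -(ler_pXn2r (n := 2)) ?nnegrE ?rnorm_ge0 ?(ltW md0) //.
  apply: le_trans (defect x Vx x1) _.
  rewrite mulrC -ler_pdivlMr ?mulr_gt0 //.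
  by rewrite (le_trans (ltW hx)) // ltW.
have Ve : V e.
  move=> v vs; apply/cabs_eq0/eqP; rewrite eq_le cabs_ge0 andbT.
  apply: (@small_le0 R _ (rnorm v)) => d /approx[x [Vx _ _ ex]].
  have -> : inner H1 e v = inner H1 (e - x) v by rewrite innerBl (Vx v) // subr0.
  apply: le_trans (cauchy_schwarz _ _) _.
  by rewrite mulrC ler_wpM2l ?rnorm_ge0.
have e1 : rnorm e <= 1.
  apply/ler_addgt0Pr => d /approx[x [_ x1 _ ex]].
  by have := rnormD (e - x) x; rewrite subrK; lra.
have Ae : rnorm (A e) = m.
  apply/eqP; rewrite eq_le; apply/andP; split.
    by apply: le_trans (hm _ Ve) _; rewrite ler_piMr.
  rewrite -subr_le0; apply: (@small_le0 R _ (M + 1)) => d /approx[x [_ _ hx ex]].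
  have := rnormD (A x - A e) (A e); rewrite subrK -(linB lA).
  have := hM (x - e); rewrite rnorm_distC.
  have : M * rnorm (e - x) <= M * d by rewrite ler_wpM2l.
  rewrite mulrDl mul1r; lra.
exists e; split => //; rewrite Ae //.
(* Since |A e| = m, the bound [defect] at e itself is 0, which is the eigenvalue equation. *)
apply/eqP; rewrite -subr_eq0; apply/eqP/rnorm_eq0/eqP; rewrite -sqrf_eq0.
by rewrite eq_le sqr_ge0 andbT (le_trans (defect e Ve e1)) // Ae subrr mulr0.
Qed.

(** Lengths are only bounded by 1, because e k may be 0 once A vanishes on the remaining complement.
    Where A (e k) is nonzero, the maximality clause applied to e k itself forces length 1. *)
Definition singular_basis (e : nat -> H1) : Prop := forall k,
  [/\ forall j, (j < k)%N -> inner H1 (e k) (e j) = 0, rnorm (e k) <= 1,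
    forall x, (forall j, (j < k)%N -> inner H1 x (e j) = 0) ->
      rnorm (A x) <= rnorm (A (e k)) * rnorm x &
    T (e k) = (rnorm (A (e k)) ^+ 2)%:C%C *: e k].

Lemma singular_basis_exists : exists e, singular_basis e.
Proof.
have /choice[next hnext] : forall s, exists e, gram_eigenvectors s ->
    [/\ perp s e, rnorm e <= 1,
    forall x, perp s x -> rnorm (A x) <= rnorm (A e) * rnorm x &
    T e = (rnorm (A e) ^+ 2)%:C%C *: e].
  move=> s; have [/max_singular_vector[e he]|ns] := pselect (gram_eigenvectors s).
    by exists e.
  (* A dummy value: every list [p n] built below consists of eigenvectors. *)
  by exists 0.
pose p := fix p n := if n is n'.+1 then rcons (p n') (next (p n')) else [::].
have pE n : p n = [seq next (p j) | j <- iota 0 n].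
  by elim: n => // n IH; rewrite -[in iota _ _]addn1 iotaD map_cat add0n -IH cats1.
have eig n : gram_eigenvectors (p n).
  elim: n => [|n IH] u //=; rewrite mem_rcons inE => /orP[/eqP ->|/IH //].
  by have [_ _ _ Te] := hnext _ IH; eexists; exact: Te.
exists (fun n => next (p n)) => k.
have [pe e1 he Te] := hnext _ (eig k); split => //.
  by move=> j jk; apply: pe; rewrite (pE k); apply/mapP; exists j; rewrite ?mem_iota.
move=> x hx; apply: he => u; rewrite (pE k) => /mapP[j].
by rewrite mem_iota add0n => /andP[_ jk] ->; exact: hx.
Qed.

End Singular_vectors.

(** * Singular values *)

(** More rows than columns make the rows dependent. This gives both the invariance of dimension and
    a common zero of k functionals in the span of k + 1 vectors. *)
Lemma exists_left_kernel (F : fieldType) (n m : nat) (B : 'I_n -> 'I_m -> F) :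
  (m < n)%N -> exists c : 'I_n -> F,
    (exists i, c i != 0) /\ forall j, \sum_i c i * B i j = 0.
Proof.
move=> mn; pose M := \matrix_(i, j) B i j.
have : kermx M != 0.
  rewrite kermx_eq0 /row_free; apply: contraTneq (rank_leq_col M) => ->.
  by rewrite -ltnNge.
move=> /rowV0Pn[c /sub_kermxP cM c0]; exists (fun i => c 0 i); split.
  by have /rV0Pn := c0.
move=> j; have /matrixP/(_ 0 j) := cM; rewrite !mxE => E; rewrite -[RHS]E.
by apply: eq_bigr => i _; rewrite mxE.
Qed.

(** * Uniqueness of the eigenvalue sequence *)

Section Eigenvalue_sequence_unique.
Variable R : realType.

Lemma has_dim_le (H : hilbertSpace R) (V : set H) n m :
  has_dim V n -> has_dim V m -> (n <= m)%N.
Proof.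
move=> [e [e_free VE]] [e' [_ VE']]; rewrite leqNgt; apply/negP => mn.
have /choice[B hB] : forall i, exists b : 'I_m -> R[i], e i = \sum_j b j *: e' j.
  move=> i; have : V (e i).
    rewrite VE /=; exists (fun j => (j == i)%:R).
    rewrite (bigD1 i) //= eqxx scale1r big1 ?addr0 // => j /negbTE ->.
    by rewrite scale0r.
  by rewrite VE'.
have [c [[i ci] hc]] := exists_left_kernel B mn.
move/negP: ci; apply; apply/eqP; apply: e_free.
under eq_bigr do rewrite hB scaler_sumr.
rewrite exchange_big /= big1 // => j _.
by under eq_bigr do rewrite scalerA; rewrite -scaler_suml hc scale0r.
Qed.

Lemma has_dim_unique (H : hilbertSpace R) (V : set H) n m :
  has_dim V n -> has_dim V m -> n = m.
Proof. by move=> hn hm; apply/eqP; rewrite eqn_leq !(has_dim_le _ (V := V)). Qed.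

(** Were a k > b k, the level set of b at the value a k would lie below k, where a and b agree; so
    it would be contained in the level set of a, which also contains k, against equal
    cardinality. *)
Lemma level_sets_le (a b : nat -> R) k :
  nonincreasing_seq b -> (forall k, 0 <= b k) ->
  (forall lam, 0 < lam -> exists n,
    [set k | a k = lam] #= `I_n /\ [set k | b k = lam] #= `I_n) ->
  (forall j, (j < k)%N -> a j = b j) -> a k <= b k.
Proof.
move=> b_mono b0 hab ab; rewrite leNgt; apply/negP => ba.
have [n [ha hb]] := hab (a k) (le_lt_trans (b0 k) ba).
pose Sa := [set j | a j = a k]; pose Sb := [set j | b j = a k].
have finSa : finite_set Sa by exists n.
have finSb : finite_set Sb by exists n.
have jk j : Sb j -> (j < k)%N.
  move=> /= bj; rewrite ltnNge; apply/negP => /b_mono.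
  by rewrite bj leNgt ba.
have : (fset_set Sb `<` fset_set Sa)%fset.
  rewrite fproperE; apply/andP; split.
    apply/fsubsetP => j; rewrite !in_fset_set // => /set_mem Sbj; apply/mem_set.
    by rewrite /Sa /= (ab _ (jk _ Sbj)).
  apply/negP => /fsubsetP/(_ k).
  rewrite !in_fset_set // => /(_ (mem_set erefl))/set_mem/jk.
  by rewrite ltnn.
move=> /fproper_ltn_card; rewrite (card_fset_set ha) (card_fset_set hb).
by rewrite ltnn.
Qed.

Lemma eigenvalue_sequence_unique (H : hilbertSpace R) (T : H -> H) (a b : nat -> R) :
  eigenvalue_sequence T a -> eigenvalue_sequence T b -> a = b.
Proof.
move=> [a_mono a0 ha] [b_mono b0 hb].
have hab lam : 0 < lam -> exists n,
    [set k | a k = lam] #= `I_n /\ [set k | b k = lam] #= `I_n.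
  move=> l0; have [n [Vn an]] := ha lam l0; have [m [Vm bm]] := hb lam l0.
  by exists n; split; rewrite // (has_dim_unique Vn Vm).
apply/funext => k; elim/ltn_ind: k => k IH; apply/eqP; rewrite eq_le.
rewrite !level_sets_le // => [lam l0|j jk]; last by rewrite IH.
by have [n []] := hab lam l0; exists n.
Qed.

End Eigenvalue_sequence_unique.

(** * Singular values computed from a singular basis *)

Section Singular_value.
Variables (R : realType) (H1 H2 : hilbertSpace R) (A : H1 -> H2).
Hypothesis cA : compact_operator A.
Let T : H1 -> H1 := adjoint A \o A.

Variable e : nat -> H1.
Hypothesis he : singular_basis A e.
Let a k : R := rnorm (A (e k)) ^+ 2.

Lemma singular_basis_orth i j : i != j -> inner H1 (e i) (e j) = 0.
Proof.
rewrite neq_ltn => /orP[] ij.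
  by rewrite innerC; have [orth _ _ _] := he j; rewrite orth // conjC0.
by have [orth _ _ _] := he i; exact: orth.
Qed.

Lemma singular_basis_unit k : 0 < a k -> inner H1 (e k) (e k) = 1.
Proof.
move=> ak; have Ak : 0 < rnorm (A (e k)).
  rewrite lt_def rnorm_ge0 andbT; apply: contraTneq ak => Ak0.
  by rewrite /a Ak0 expr0n ltxx.
have [orth e1 hk _] := he k; rewrite innerxx.
have : 1 <= rnorm (e k) by rewrite -(ler_pM2l Ak) mulr1; exact: hk.
move=> e1'; have -> : rnorm (e k) = 1 by apply/eqP; rewrite eq_le e1.
by rewrite expr1n.
Qed.

Lemma singular_basis_mono : nonincreasing_seq a.
Proof.
apply/nonincreasing_seqP => k; rewrite ler_pXn2r ?nnegrE ?rnorm_ge0 //.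
have [orth e1 _ _] := he k.+1; have [_ _ hk _] := he k.
apply: le_trans (hk _ _) _; first by move=> j jk; exact: orth (ltnW jk).
by rewrite ler_piMr ?rnorm_ge0.
Qed.

(** Otherwise the vectors A (e k) would be pairwise orthogonal with squared length at least lam,
    hence at squared distance at least 2 lam, and could not cluster as compactness demands. *)
Lemma singular_basis_small (lam : R) : 0 < lam -> exists N, a N < lam.
Proof.
move=> l0; apply: contrapT => /forallNP hN.
have {}hN k : lam <= a k by rewrite leNgt; apply/negP/hN.
have [z [phi hphi]] : exists z (phi : nat -> nat), forall j,
    (j <= phi j)%N /\ rnorm (A (e (phi j)) - z) < j.+1%:R^-1.
  apply: (precompact_subseq cA.2 (u := A \o e)) => n.
  by exists (e n) => //; case: (he n).
have d0 : 0 < Num.sqrt lam / 2 by rewrite divr_gt0 // sqrtr_gt0.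
have [N small] := natSinv_small d0.
(* Starting beyond [phi N] guarantees that [phi j] and [phi N] are distinct. *)
have [p1 h1] := hphi N; pose j := (phi N).+1; have [p2 h2] := hphi j.
have Nj : (N <= j)%N by rewrite ltnW.
have {}h1 := lt_trans h1 (small _ (leqnn _)).
have {}h2 := lt_trans h2 (small _ Nj).
set x := A (e (phi N)) in h1; set y := A (e (phi j)) in h2.
have hxy : rnorm (x - y) < Num.sqrt lam.
  by have := rnorm_distD z x y; rewrite [rnorm (z - y)]rnorm_distC; lra.
have : rnorm (x - y) ^+ 2 < lam.
  rewrite -[ltRHS](sqr_sqrtr (ltW l0)).
  by rewrite ltr_pXn2r ?nnegrE ?rnorm_ge0 ?sqrtr_ge0.
rewrite rnormB_sqr; have -> : inner H2 x y = 0.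
  rewrite -(inner_gram cA); have [_ _ _] := he (phi j).
  rewrite /T /= => ->; rewrite innerZr singular_basis_orth ?mulr0 //.
  by rewrite neq_ltn p2.
have := hN (phi N); have := hN (phi j); rewrite /a -/x -/y /=; lra.
Qed.

(** The e k with a k = lam are orthonormal eigenvectors, all with k < N. An eigenvector x minus its
    projection onto their span is orthogonal to every e j with j < N, so maximality at N gives lam
    |x - y|^2 = |A (x - y)|^2 <= a N |x - y|^2, and a N < lam forces x = y. *)
Lemma singular_basis_eigenspace_dim (lam : R) : 0 < lam ->
  exists n, has_dim (Defs.eigenspace T lam) n /\ [set k | a k = lam] #= `I_n.
Proof.
move=> l0; have [N aN] := singular_basis_small l0.
pose s := [seq k <- iota 0 N | a k == lam].
have s_uniq : uniq s by rewrite filter_uniq // iota_uniq.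
have sP k : (k \in s) = (a k == lam).
  rewrite mem_filter mem_iota add0n; case: eqP => //= ak; rewrite ltnNge.
  by apply/negP => /singular_basis_mono; rewrite ak leNgt aN.
exists (size s); split; last first.
  have -> : [set k | a k = lam] = nth 0%N s @` `I_(size s).
    apply/seteqP; split=> [k /eqP|_ /= [i ilt <-]]; last first.
      by apply/eqP; rewrite -sP mem_nth.
    by rewrite -sP => ks; exists (index k s); rewrite /= ?index_mem ?nth_index.
  apply: inj_card_eq => i j /set_mem /= ilt /set_mem /= jlt /eqP.
  by rewrite nth_uniq // => /eqP.
pose v (i : 'I_(size s)) := e (nth 0%N s i).
have vv i j : inner H1 (v i) (v j) = (i == j)%:R.
  have [->|ij] := eqVneq i j.
    apply: singular_basis_unit; rewrite (eqP (_ : a _ == lam)) //.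
    by rewrite -sP mem_nth.
  by apply: singular_basis_orth; rewrite nth_uniq.
have coord (c : 'I_(size s) -> R[i]) j : inner H1 (\sum_i c i *: v i) (v j) = c j.
  rewrite inner_suml (bigD1 j) //= innerZl vv eqxx mulr1 big1 ?addr0 // => i ij.
  by rewrite innerZl vv (negbTE ij) mulr0.
have Te k : T (e k) = (a k)%:C%C *: e k by have [] := he k.
have Tv i : T (v i) = lam%:C%C *: v i.
  by rewrite /v Te (eqP (_ : a _ == lam)) // -sP mem_nth.
have lT : linear T := gram_linear cA.
exists v; split => [c hc j|]; first by rewrite -(coord c j) hc inner0l.
apply/seteqP; split => [x /= Tx|_ /= [c ->]]; last first.
  rewrite /Defs.eigenspace /= (lin_sum lT) scaler_sumr; apply: eq_bigr => i _.
  by rewrite (linZ lT) Tv !scalerA mulrC.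
exists (fun i => inner H1 x (v i)).
set y := \sum_i _; apply/eqP; rewrite -subr_eq0; apply/eqP.
have Txy : T (x - y) = lam%:C%C *: (x - y).
  rewrite (linB lT) Tx scalerBr; congr (_ - _).
  rewrite (lin_sum lT) scaler_sumr; apply: eq_bigr => i _.
  by rewrite (linZ lT) Tv !scalerA mulrC.
have xy_perp j : (j < N)%N -> inner H1 (x - y) (e j) = 0.
  move=> jN; have [aj|aj] := eqVneq (a j) lam.
    have js : (j \in s) by rewrite sP aj.
    have jlt : (index j s < size s)%N by rewrite index_mem.
    have -> : e j = v (Ordinal jlt) by rewrite /v /= nth_index.
    by rewrite innerBl coord subrr.
  have : inner H1 (T (x - y)) (e j) = inner H1 (x - y) (T (e j)).
    by rewrite innerC (inner_gram cA) -innerC -(inner_gram cA).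
  rewrite Txy Te innerZl innerZr conj_real => /eqP.
  rewrite -subr_eq0 -mulrBl mulf_eq0 => /orP[|/eqP //].
  by rewrite -rmorphB /= (inj_eq (@complexI R) _ 0) subr_eq0 eq_sym (negbTE aj).
have [_ _ /(_ _ xy_perp) hy _] := he N.
have : lam * rnorm (x - y) ^+ 2 = rnorm (A (x - y)) ^+ 2.
  by rewrite -(Re_gram cA) -/(T _) Txy innerZl Re_realM innerxx.
have : rnorm (A (x - y)) ^+ 2 <= a N * rnorm (x - y) ^+ 2.
  by rewrite -exprMn ler_pXn2r ?nnegrE ?mulr_ge0 ?rnorm_ge0.
move=> h1 h2; apply: rnorm_eq0; apply/eqP; rewrite -sqrf_eq0 eq_le sqr_ge0 andbT.
by rewrite leNgt; apply/negP => n0; move: h1; rewrite -h2 ler_pM2r // leNgt aN.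
Qed.

Lemma singular_basis_eigenvalues : eigenvalue_sequence T a.
Proof.
split; [exact: singular_basis_mono|by move=> k; exact: sqr_ge0|].
exact: singular_basis_eigenspace_dim.
Qed.

(** Existence makes [get] return some eigenvalue sequence, and uniqueness identifies it with a. *)
Lemma singular_valueE k : singular_value A k = rnorm (A (e k)).
Proof.
rewrite /singular_value; have E := singular_basis_eigenvalues.
have := getPex (ex_intro (eigenvalue_sequence (adjoint A \o A)) _ E).
move=> /(eigenvalue_sequence_unique)/(_ E) ->.
by rewrite sqrtr_sqr ger0_norm // rnorm_ge0.
Qed.

(* The functionals need not be bounded, so that precomposition with an operator
   requires no adjoint. *)
Definition gelfand_le (k : nat) (t : R) : Prop :=
  exists f : 'I_k -> H1 -> R[i],
    (forall i c x y, f i (c *: x + y) = c * f i x + f i y) /\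
    forall x, (forall i, f i x = 0) -> rnorm (A x) <= t * rnorm x.

Lemma singular_basis_gelfand k : gelfand_le k (rnorm (A (e k))).
Proof.
exists (fun i x => inner H1 x (e i)); split=> [i c x y|x hx].
  by rewrite innerDl innerZl.
by have [_ _ hk _] := he k; apply: hk => j jk; exact: (hx (Ordinal jk)).
Qed.

(** If t < |A (e k)|, then a i > 0 for all i <= k, so e 0, ..., e k are orthonormal and |A x|^2 =
    sum a_i |c_i|^2 >= a_k |x|^2 on their span. A nonzero x there killed by the functionals
    contradicts smallness. *)
Lemma gelfand_singular_basis k (t : R) : 0 <= t -> gelfand_le k t ->
  rnorm (A (e k)) <= t.
Proof.
move=> t0 [f [f_lin hf]]; rewrite leNgt; apply/negP => tk.
have a_ge (i : 'I_k.+1) : a k <= a i.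
  by apply: singular_basis_mono; rewrite -ltnS.
have a_gt0 (i : 'I_k.+1) : 0 < a i.
  by apply: lt_le_trans (a_ge i); rewrite exprn_gt0 // (le_lt_trans t0).
have ee (i j : 'I_k.+1) : inner H1 (e i) (e j) = (i == j)%:R.
  have [->|ij] := eqVneq i j; first exact: singular_basis_unit.
  exact: singular_basis_orth.
have [c [[i0 ci0] hc]] :=
  exists_left_kernel (fun (i : 'I_k.+1) (j : 'I_k) => f j (e i)) (ltnSn k).
pose x := \sum_(i < k.+1) c i *: e i.
have fx j : f j x = 0.
  have f0 : f j 0 = 0.
    by have := f_lin j (-1) 0 0; rewrite scaler0 addr0 mulN1r addNr.
  rewrite -(hc j) /x; elim/big_rec2: _ => [|i p q _ <-]; first exact: f0.
  by rewrite f_lin.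
have coord (j : 'I_k.+1) : inner H1 (e j) x = Num.conj (c j).
  rewrite innerC inner_suml (bigD1 j) //= innerZl ee eqxx mulr1 big1 ?addr0 //.
  by move=> i ij; rewrite innerZl ee (negbTE ij) mulr0.
have nx : rnorm x ^+ 2 = \sum_(i < k.+1) cabs (c i) ^+ 2.
  apply/(@complexI R); rewrite -innerxx [in LHS]/x inner_suml rmorph_sum /=.
  by apply: eq_bigr => i _; rewrite innerZl -/x coord cabs_sqr.
have nAx : rnorm (A x) ^+ 2 = \sum_(i < k.+1) a i * cabs (c i) ^+ 2.
  have lT : linear T := gram_linear cA.
  rewrite -(Re_gram cA) -/(T _) (lin_sum lT) inner_suml raddf_sum /=.
  apply: eq_bigr => i _.
  have Te : T (e i) = (a i)%:C%C *: e i by have [] := he i.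
  by rewrite (linZ lT) Te scalerA mulrC -scalerA !innerZl coord Re_realM -cabs_sqr.
have x_gt0 : 0 < rnorm x ^+ 2.
  rewrite nx (bigD1 i0) //=; apply: ltr_wpDr.
    by apply: sumr_ge0 => i _; exact: sqr_ge0.
  rewrite exprn_gt0 // lt_def cabs_ge0 andbT.
  by apply: contraNneq ci0 => /cabs_eq0 ->.
have : a k * rnorm x ^+ 2 <= rnorm (A x) ^+ 2.
  rewrite nAx nx mulr_sumr; apply: ler_sum => i _.
  by rewrite ler_wpM2r ?sqr_ge0.
have : rnorm (A x) ^+ 2 <= t ^+ 2 * rnorm x ^+ 2.
  by rewrite -exprMn ler_pXn2r ?nnegrE ?mulr_ge0 ?rnorm_ge0 // hf.
move=> h1 /le_trans/(_ h1); rewrite ler_pM2r // ler_pXn2r ?nnegrE ?rnorm_ge0 //.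
by rewrite leNgt tk.
Qed.

End Singular_value.

Section Singular_value_gelfand.
Variable R : realType.
Implicit Types H : hilbertSpace R.

Lemma singular_value_gelfand H1 H2 (A : H1 -> H2) k :
  compact_operator A -> gelfand_le A k (singular_value A k).
Proof.
move=> cA; have [e he] := singular_basis_exists cA.
by rewrite (singular_valueE cA he); exact: singular_basis_gelfand.
Qed.

Lemma singular_value_le H1 H2 (A : H1 -> H2) k (t : R) :
  compact_operator A -> 0 <= t -> gelfand_le A k t -> singular_value A k <= t.
Proof.
move=> cA t0 hk; have [e he] := singular_basis_exists cA.
by rewrite (singular_valueE cA he); exact: (gelfand_singular_basis cA he).
Qed.

End Singular_value_gelfand.

(** * The ideal axioms *)

Section Compact_operators.
Variable R : realType.
Implicit Types H : hilbertSpace R.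

Lemma totally_bounded_subset (V : normedModType R[i]) (S S' : set V) :
  S `<=` S' -> totally_bounded S' -> totally_bounded S.
Proof. by move=> SS' tS' e /tS'[s hs]; exists s => x /SS'/hs. Qed.

Lemma totally_bounded_image (V W : normedModType R[i]) (f : V -> W) (S : set V)
    (L : R) : 0 <= L -> (forall x y, rnorm (f x - f y) <= L * rnorm (x - y)) ->
  totally_bounded S -> totally_bounded (f @` S).
Proof.
move=> L0 hf tS e e0; have L1 : 0 < L + 1 by rewrite ltr_wpDl.
have [s hs] := tS _ (divr_gt0 e0 L1); exists (map f s) => _ [x /hs[y ys xy] <-].
exists (f y); first exact: map_f.
apply: le_lt_trans (hf x y) _; move: xy; rewrite ltr_pdivlMr // mulrC.
by apply: le_lt_trans; rewrite ler_wpM2r ?rnorm_ge0 // lerDl.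
Qed.

Lemma compact_operatorP H1 H2 (A : H1 -> H2) :
  compact_operator A <-> linear A /\ totally_bounded (A @` unit_ball (H := H1)).
Proof.
split=> -[lA h]; split => //.
  exact: precompact_totally_bounded.
exact: totally_bounded_precompact.
Qed.

Lemma linear_comp H1 H2 H3 (B : H2 -> H3) (A : H1 -> H2) :
  linear B -> linear A -> linear (B \o A).
Proof. by move=> lB lA a x y; rewrite /= lA lB. Qed.

Lemma linear_add H1 H2 (A B : H1 -> H2) : linear A -> linear B -> linear (A + B).
Proof.
move=> lA lB a x y; rewrite /GRing.add /= lA lB.
by rewrite scalerDr addrACA.
Qed.

Lemma compact_operator0 H1 H2 : compact_operator (0 : H1 -> H2).
Proof.
apply/compact_operatorP; split=> [a x y|e e0].
  by rewrite [LHS]/(0 : H2) scaler0 addr0.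
exists [:: 0] => _ [x _ <-]; exists 0; rewrite ?mem_head //.
by rewrite subr0 rnorm0.
Qed.

Lemma compact_operator_add H1 H2 (A B : H1 -> H2) :
  compact_operator A -> compact_operator B -> compact_operator (A + B).
Proof.
move=> /compact_operatorP[lA tA] /compact_operatorP[lB tB].
apply/compact_operatorP; split=> [|e e0]; first exact: linear_add.
have e2 : 0 < e / 2 by rewrite divr_gt0.
have [s hs] := tA _ e2; have [t ht] := tB _ e2.
exists [seq x + y | x <- s, y <- t] => _ [x x1 <-].
have [y ys xy] := hs (A x) (imageP _ x1); have [z zt xz] := ht (B x) (imageP _ x1).
exists (y + z); first by apply/allpairsP; exists (y, z).
rewrite [(A + B) x]/(A x + B x) opprD addrACA [ltRHS]splitr.
exact: le_lt_trans (rnormD _ _) (ltrD xy xz).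
Qed.

Lemma compact_operator_compl H1 H2 H3 (B : H2 -> H3) (A : H1 -> H2) :
  bounded_operator B -> compact_operator A -> compact_operator (B \o A).
Proof.
move=> bB /compact_operatorP[lA tA]; apply/compact_operatorP; split.
  by apply: linear_comp => //; case: bB.
rewrite -image_comp; apply: (totally_bounded_image (opnorm_ge0 bB)) tA => x y.
by rewrite -(linB bB.1) opnorm_bound.
Qed.

Lemma scale_bounded H (c : R[i]) : bounded_operator (fun x : H => c *: x).
Proof.
split=> [a x y|]; first by rewrite scalerDr !scalerA mulrC.
by exists (cabs c) => x; rewrite rnormZ.
Qed.

Lemma compact_operator_scale H1 H2 (c : R[i]) (A : H1 -> H2) :
  compact_operator A -> compact_operator (c *: A).
Proof. exact: (compact_operator_compl (scale_bounded H2 c)). Qed.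

Lemma compact_operator_compr H1 H2 H3 (A : H2 -> H3) (C : H1 -> H2) :
  compact_operator A -> bounded_operator C -> compact_operator (A \o C).
Proof.
move=> cA bC; have [lA _] := cA; have lC := bC.1.
(* C maps the unit ball into L times the unit ball, so its image under A \o C lies in that of the
   ball under L A; the added 1 makes L invertible. *)
pose L := opnorm C + 1; have L0 : 0 < L by rewrite ltr_wpDl ?opnorm_ge0.
have /compact_operatorP[_ tLA] := compact_operator_scale L%:C%C cA.
apply/compact_operatorP; split; first exact: linear_comp.
apply: totally_bounded_subset tLA => _ [x /= x1 <-].
exists (L^-1%:C%C *: C x); last first.
  change (L%:C%C *: A (L^-1%:C%C *: C x) = A (C x)).
  rewrite (linZ lA) scalerA -rmorphM /= divff ?gt_eqF //.
  by rewrite scale1r.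
rewrite /unit_ball /= rnormZ cabs_real gtr0_norm ?invr_gt0 // mulrC.
rewrite ler_pdivrMr // mul1r; apply: le_trans (opnorm_bound bC x) _.
by apply: le_trans (ler_piMr (opnorm_ge0 bC) x1) _; rewrite lerDl.
Qed.

Lemma compact_operator_limit H1 H2 (A : H1 -> H2) : linear A ->
  (forall e : R, 0 < e -> exists2 B : H1 -> H2, compact_operator B &
     forall x, rnorm (A x - B x) <= e * rnorm x) ->
  compact_operator A.
Proof.
move=> lA hA; apply/compact_operatorP; split=> // e e0.
have e2 : 0 < e / 2 by rewrite divr_gt0.
have [B /compact_operatorP[_ tB] AB] := hA _ e2.
have [s hs] := tB _ e2; exists s => _ [x x1 <-].
have [y ys xy] := hs (B x) (imageP _ x1); exists y => //.
have := rnorm_distD (B x) (A x) y; have := AB x.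
have : e / 2 * rnorm x <= e / 2 by rewrite ler_piMr // ltW.
lra.
Qed.

Lemma cabs_le_ReIm (z : R[i]) : cabs z <= `|complex.Re z| + `|complex.Im z|.
Proof.
rewrite [in cabs z](complexE z); apply: le_trans (cabsD _ _) _.
have ci : cabs 'i = 1 :> R.
  by rewrite /cabs normc_def /= expr0n /= expr1n add0r sqrtr1.
by rewrite cabsM !cabs_real ci mul1r.
Qed.

Lemma complex_id_compact :
  compact_operator (idfun : complex_hilbert R -> complex_hilbert R).
Proof.
apply/compact_operatorP; split => // e e0.
have e2 : 0 < e / 2 by rewrite divr_gt0.
have [N /(_ _ (leqnn _)) hN] := natSinv_small e2.
have N0 : 0 < N.+1%:R :> R by rewrite ltr0n.
(* A grid on [-1, 1] of mesh 1/(N+1) < e/2, with 2 (N + 1) + 1 points, used for the real and the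
   imaginary part. *)
pose g (p : nat) : R := p%:R / N.+1%:R - 1.
have approx (a : R) : `|a| <= 1 ->
    exists2 p, (p < N.+1.*2.+1)%N & `|a - g p| <= N.+1%:R^-1.
  rewrite ler_norml => /andP[a1 a2].
  have b0 : 0 <= (a + 1) * N.+1%:R by rewrite mulr_ge0 // -lerBlDr sub0r.
  have /andP[t1 t2] := Num.Theory.truncn_itv b0.
  exists (Num.truncn ((a + 1) * N.+1%:R)).
    rewrite ltnS -(ler_nat R) (le_trans t1) // -muln2 natrM mulrC ler_pM2l //.
    by rewrite -lerBrDr; have -> : 2%:R - 1 = 1 :> R by lra.
  rewrite /g; set p := Num.truncn _.
  have -> : a - (p%:R / N.+1%:R - 1) = ((a + 1) * N.+1%:R - p%:R) / N.+1%:R.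
    by field; rewrite gt_eqF.
  rewrite normrM [X in _ * X]gtr0_norm ?invr_gt0 // ler_piMl ?invr_ge0 ?ler0n //.
  by rewrite ger0_norm ?subr_ge0 // lerBlDr nat1r ltW.
pose G p q : complex_hilbert R := g p +i* g q.
exists [seq G p q | p <- iota 0 N.+1.*2.+1, q <- iota 0 N.+1.*2.+1].
move=> _ [z z1 <-]; have {}z1 : cabs (z : R[i]) <= 1 by [].
have [p pN hp] := approx _ (le_trans (Re_le_cabs z) z1).
have Im_le : `|complex.Im (z : R[i])| <= 1.
  apply: le_trans z1; case: (z : R[i]) => a b.
  by rewrite /cabs normc_def /= -sqrtr_sqr ler_wsqrtr // lerDr sqr_ge0.
have [q qN hq] := approx _ Im_le.
exists (G p q); first by apply: allpairs_f; rewrite mem_iota.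
apply: le_lt_trans (cabs_le_ReIm (z - (g p +i* g q) : R[i])) _.
move: hp hq; case: (z : R[i]) => a b /= hp hq.
rewrite [ltRHS]splitr; apply: ltrD; first exact: le_lt_trans hp hN.
exact: le_lt_trans hq hN.
Qed.

End Compact_operators.

(** * Calculus of smallness *)

Section Gelfand.
Variable R : realType.
Implicit Types H : hilbertSpace R.

Lemma gelfand_le_bound H1 H2 (A : H1 -> H2) (t : R) :
  gelfand_le A 0 t <-> forall x, rnorm (A x) <= t * rnorm x.
Proof.
split=> [[f [_ h]] x|h]; first by apply: h => -[].
by exists (fun _ _ => 0); split=> // -[].
Qed.

Lemma gelfand_le_mono H1 H2 (A : H1 -> H2) k l (s t : R) :
  (k <= l)%N -> s <= t -> gelfand_le A k s -> gelfand_le A l t.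
Proof.
move=> kl st [f [f_lin hf]].
(* The list of functionals is padded with zeros from index k on. *)
exists (fun i x => if insub (val i) is Some j then f j x else 0); split.
  by move=> i c x y; case: insubP => [j _ _|_]; rewrite ?f_lin // mulr0 addr0.
move=> x hx; apply: le_trans (hf x _) _; last by rewrite ler_wpM2r ?rnorm_ge0.
by move=> i; have := hx (widen_ord kl i); rewrite /= valK.
Qed.

Lemma gelfand_le_add H1 H2 (A B : H1 -> H2) k l (s t : R) :
  gelfand_le A k s -> gelfand_le B l t -> gelfand_le (A + B) (k + l) (s + t).
Proof.
move=> [f [f_lin hf]] [g [g_lin hg]].
exists (fun i x =>
  match fintype.split i with inl a => f a x | inr b => g b x end); split.
  by move=> i c x y; case: fintype.split => a; rewrite ?f_lin ?g_lin.
move=> x hx; rewrite mulrDl; apply: le_trans (rnormD (A x) (B x)) _; apply: lerD.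
  by apply: hf => i; have := hx (unsplit (inl i)); rewrite unsplitK.
by apply: hg => i; have := hx (unsplit (inr i)); rewrite unsplitK.
Qed.

Lemma gelfand_le_comp H1 H2 H3 H4 (B : H2 -> H1) (A : H3 -> H2) (C : H4 -> H3)
    k (t : R) : bounded_operator B -> bounded_operator C -> 0 <= t ->
  gelfand_le A k t -> gelfand_le (B \o A \o C) k (opnorm B * t * opnorm C).
Proof.
move=> bB bC t0 [f [f_lin hf]]; exists (fun i x => f i (C x)); split.
  by move=> i c x y; rewrite bC.1 f_lin.
move=> x /hf hx; apply: le_trans (opnorm_bound bB _) _.
rewrite -!mulrA ler_wpM2l ?opnorm_ge0 //; apply: le_trans hx _.
by rewrite ler_wpM2l // opnorm_bound.
Qed.

Lemma gelfand_le_scale H1 H2 (A : H1 -> H2) (c : R[i]) k (t : R) :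
  gelfand_le A k t -> gelfand_le (c *: A) k (cabs c * t).
Proof.
move=> [f [f_lin hf]]; exists f; split=> // x /hf hx.
by rewrite [(c *: A) x]/(c *: A x) rnormZ -mulrA ler_wpM2l ?cabs_ge0.
Qed.

End Gelfand.

(** * The classes E_w and their quasi-norm *)

Section Ideal.
Variables (R : realType) (w : nat -> R).
Hypothesis hw : weight w.
Implicit Types H : hilbertSpace R.
Let w_ge0 k : 0 <= w k. Proof. by case: hw. Qed.

Lemma E_bounds_lb H1 H2 (A : H1 -> H2) : has_lbound (E_bounds w A).
Proof. by exists 0 => M []. Qed.

(** The way back from smallness to the class; [E_norm_gelfand] is the way in. Most axioms are proved
    by passing through both. *)
Lemma E_intro H1 H2 (A : H1 -> H2) (M : R) : compact_operator A -> 0 <= M ->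
  (forall k, gelfand_le A k (M * w k)) -> E_class w A /\ E_norm w A <= M.
Proof.
move=> cA M0 hM; have bM : E_bounds w A M.
  by split=> // k; apply: singular_value_le; rewrite // mulr_ge0.
by split; [split=> //; exists M|by apply: ge_inf => //; exact: E_bounds_lb].
Qed.

Lemma E_norm_ge0 H1 H2 (A : H1 -> H2) : E_class w A -> 0 <= E_norm w A.
Proof. by move=> [_ nA]; apply: lb_le_inf => // M []. Qed.

(* The infimum defining E_norm is attained. *)
Lemma E_norm_gelfand H1 H2 (A : H1 -> H2) : E_class w A ->
  forall k, gelfand_le A k (E_norm w A * w k).
Proof.
move=> [cA nA] k; apply: gelfand_le_mono (leqnn k) _ (singular_value_gelfand k cA).
(* Division by w k is impossible here, but any admissible M already forces this singular value to be
   at most 0. *)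
have [wk|wk] := eqVneq (w k) 0.
  by have [M [_ /(_ k)]] := nA; rewrite wk !mulr0.
have wk0 : 0 < w k by rewrite lt_def wk w_ge0.
rewrite -ler_pdivrMr //; apply: lb_le_inf => // M [_ /(_ k)].
by rewrite ler_pdivrMr.
Qed.

(** Index 0 involves no functional, so the quasi-norm controls the operator norm. *)
Lemma E_norm_bound H1 H2 (A : H1 -> H2) : E_class w A ->
  forall x, rnorm (A x) <= E_norm w A * w 0%N * rnorm x.
Proof. by move=> /E_norm_gelfand/(_ 0%N)/gelfand_le_bound. Qed.

Lemma E_zero H1 H2 : E_class w (0 : H1 -> H2) /\ E_norm w (0 : H1 -> H2) = 0.
Proof.
have [|//|k|h1 h2] := @E_intro H1 H2 0 0; first exact: compact_operator0.
  rewrite mul0r; apply: (@gelfand_le_mono _ _ _ _ 0 k 0 0) => //.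
  by apply/gelfand_le_bound => x; rewrite rnorm0 mul0r.
by split=> //; apply/eqP; rewrite eq_le h2 E_norm_ge0.
Qed.

Lemma E_scale_le H1 H2 (c : R[i]) (A : H1 -> H2) : E_class w A ->
  E_class w (c *: A) /\ E_norm w (c *: A) <= cabs c * E_norm w A.
Proof.
move=> EA; apply: E_intro.
- exact: compact_operator_scale EA.1.
- by rewrite mulr_ge0 ?cabs_ge0 ?E_norm_ge0.
by move=> k; rewrite -mulrA; exact/gelfand_le_scale/E_norm_gelfand.
Qed.

(** For c nonzero, the reverse inequality is [E_scale_le] applied to c^-1 and c A. *)
Lemma E_norm_scale H1 H2 (c : R[i]) (A : H1 -> H2) : E_class w A ->
  E_norm w (c *: A) = cabs c * E_norm w A.
Proof.
move=> EA; have [EcA le1] := E_scale_le c EA.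
have [->|c0] := eqVneq c 0.
  by rewrite scale0r (E_zero H1 H2).2 /cabs normr0 mul0r.
have cabs_gt0 : 0 < cabs c.
  by rewrite lt_def cabs_ge0 andbT; apply: contraNneq c0 => /cabs_eq0 ->.
apply/eqP; rewrite eq_le le1 /=.
have [_] := E_scale_le c^-1 EcA; rewrite scalerA mulVf // scale1r.
move=> le2; rewrite -(ler_pM2l (_ : 0 < cabs c^-1)); last first.
  rewrite lt_def cabs_ge0 andbT; apply: contraNneq c0 => /cabs_eq0/eqP.
  by rewrite invr_eq0.
have cabs1 : cabs 1 = 1 :> R by rewrite /cabs normr1.
by rewrite mulrA -cabsM mulVf // cabs1 mul1r.
Qed.

Lemma E_comp H1 H2 H3 H4 (B : H2 -> H1) (A : H3 -> H2) (C : H4 -> H3) :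
  bounded_operator B -> E_class w A -> bounded_operator C ->
  E_class w (B \o A \o C) /\
  E_norm w (B \o A \o C) <= opnorm B * E_norm w A * opnorm C.
Proof.
move=> bB EA bC; apply: E_intro.
- apply: compact_operator_compr => //; apply: compact_operator_compl => //.
  exact: EA.1.
- by rewrite !mulr_ge0 ?opnorm_ge0 ?E_norm_ge0.
move=> k; rewrite mulrAC -[_ * _ * w k]mulrA; apply: gelfand_le_comp => //.
  by rewrite mulr_ge0 ?E_norm_ge0.
exact: E_norm_gelfand.
Qed.

(** The identity of C has singular values 1, 0, 0, ..., so its quasi-norm is the inverse of
    [w 0]. *)
Lemma complex_id_E : 0 < w 0%N ->
  E_class w (idfun : complex_hilbert R -> complex_hilbert R) /\
  w 0%N * E_norm w (idfun : complex_hilbert R -> complex_hilbert R) = 1.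
Proof.
move=> w0; have w1 : 0 <= (w 0%N)^-1 by rewrite invr_ge0 ltW.
have [[|k]|EI le1] := E_intro (complex_id_compact R) w1.
- by apply/gelfand_le_bound => x; rewrite mulVf ?gt_eqF // mul1r.
(* With at least one functional available, the identity itself serves: its kernel is zero. *)
- exists (fun _ x => x); split=> // x /(_ ord0) ->.
  by rewrite rnorm0 mulr0.
split=> //; apply/eqP; rewrite eq_le; apply/andP; split.
  by rewrite mulrC -ler_pdivlMr // mul1r.
have := E_norm_bound EI (1 : R[i]).
have -> : rnorm (1 : complex_hilbert R) = 1 by rewrite /rnorm normr1.
by rewrite mulr1 mulrC.
Qed.

Section Add.
Variable K : R.
Hypothesis K_ge0 : 0 <= K.
Hypothesis hK : forall k, dot_weight w k <= K * w k.

(* s_k(A + B) <= s_(k/2)(A) + s_(k/2)(B) in the 0-based indexing, and w_(k/2)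
   is the k-th term of the doubled weight. *)
Lemma E_add H1 H2 (A B : H1 -> H2) : E_class w A -> E_class w B ->
  E_class w (A + B) /\ E_norm w (A + B) <= K * (E_norm w A + E_norm w B).
Proof.
move=> EA EB; apply: E_intro.
- exact: compact_operator_add EA.1 EB.1.
- by rewrite mulr_ge0 ?addr_ge0 ?E_norm_ge0.
move=> k; apply: gelfand_le_mono _ _
  (gelfand_le_add (E_norm_gelfand EA k./2) (E_norm_gelfand EB k./2)).
  by rewrite addnn -[leqRHS]odd_double_half leq_addl.
rewrite -mulrDl mulrAC mulrC ler_wpM2r ?addr_ge0 ?E_norm_ge0 //.
exact: hK.
Qed.

Lemma E_sub H1 H2 (A B : H1 -> H2) : E_class w A -> E_class w B ->
  E_class w (A - B).
Proof.
move=> EA EB; rewrite -scaleN1r.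
exact: (E_add EA (E_scale_le (-1) EB).1).1.
Qed.

(** A Cauchy sequence converges in operator norm to a compact A. Convergence in the quasi-norm
    follows at each k from s_k(A_n - A) <= s_k(A_n - A_m) + |A_m - A|: the first term is at most e
    w_k for all large m, and the second vanishes as m grows. *)
Lemma E_complete H1 H2 (A_ : nat -> H1 -> H2) :
  (forall n, E_class w (A_ n)) ->
  (forall e : R, 0 < e -> exists N, forall m n, (N <= m)%N -> (N <= n)%N ->
     E_norm w (A_ m - A_ n) < e) ->
  exists2 A, E_class w A & E_norm w (A_ n - A) @[n --> \oo] --> (0 : R).
Proof.
move=> EA cauchyA.
have dist m n x : rnorm (A_ m x - A_ n x) <=
    E_norm w (A_ m - A_ n) * w 0%N * rnorm x.
  exact: (E_norm_bound (E_sub (EA m) (EA n))).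
pose W (x : H1) := w 0%N * rnorm x + 1.
have W_gt0 (x : H1) : 0 < W x by rewrite ltr_wpDl // mulr_ge0 ?rnorm_ge0.
have /choice[A hA] : forall x, exists l, forall e : R, 0 < e ->
    exists N, forall n, (N <= n)%N -> rnorm (A_ n x - l) < e.
  move=> x; apply: rnorm_complete => e e0.
  have [N hN] := cauchyA _ (divr_gt0 e0 (W_gt0 x)).
  exists N => m n Nm Nn; apply: le_lt_trans (dist m n x) _.
  have := hN m n Nm Nn; rewrite ltr_pdivlMr // => /le_lt_trans; apply.
  by rewrite -mulrA ler_wpM2l ?(E_norm_ge0 (E_sub (EA m) (EA n))) // lerDl.
have unif (e : R) : 0 < e -> exists N, forall n, (N <= n)%N -> forall x,
    rnorm (A_ n x - A x) <= e * (w 0%N * rnorm x).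
  move=> e0; have [N hN] := cauchyA e e0; exists N => n Nn x.
  apply/ler_addgt0Pr => d d0; have [N' hN'] := hA x d d0.
  pose m := maxn N N'.
  have := hN' m (leq_maxr _ _); have := hN n m Nn (leq_maxl _ _).
  have := dist n m x; have := rnorm_distD (A_ m x) (A_ n x) (A x).
  rewrite -mulrA => h1 h2 h3 h4.
  have : E_norm w (A_ n - A_ m) * (w 0%N * rnorm x) <= e * (w 0%N * rnorm x).
    by rewrite ler_wpM2r ?mulr_ge0 ?rnorm_ge0 // ltW.
  lra.
have lA : linear A.
  move=> a x y; apply/eqP; rewrite -subr_eq0; apply/eqP/rnorm_eq0/eqP.
  rewrite eq_le rnorm_ge0 andbT.
  (* The constant collects the errors of replacing A by [A_ N] at a x + y, x and y. *)
  apply: (@small_le0 _ _ (w 0%N * rnorm (a *: x + y)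
     + cabs a * (w 0%N * rnorm x) + w 0%N * rnorm y)) => e e0.
  have [N /(_ _ (leqnn N)) hN] := unif e e0.
  have -> : A (a *: x + y) - (a *: A x + A y) =
      - (A_ N (a *: x + y) - A (a *: x + y)) + a *: (A_ N x - A x)
      + (A_ N y - A y).
    rewrite (EA N).1.1 scalerBr !opprB opprD.
    rewrite -!addrA; congr (_ + _).
    by rewrite opprD -!addrA addrCA addKr addrCA addKr.
  apply: le_trans (rnormD _ _) _; rewrite 2!mulrDl lerD //; last by rewrite mulrC.
  apply: le_trans (rnormD _ _) _; rewrite rnormN rnormZ lerD //.
    by rewrite mulrC.
  by rewrite -mulrA ler_wpM2l ?cabs_ge0 // mulrC.
have cA : compact_operator A.
  apply: compact_operator_limit => // e e0.
  have w1 : 0 < w 0%N + 1 by rewrite ltr_wpDl.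
  have [N /(_ _ (leqnn N)) hN] := unif _ (divr_gt0 e0 w1).
  exists (A_ N) => [|x]; first exact: (EA N).1.
  rewrite rnorm_distC; apply: le_trans (hN x) _.
  rewrite mulrA ler_wpM2r ?rnorm_ge0 //.
  by rewrite mulrAC ler_pdivrMr // ler_wpM2l ?lerDl // ltW.
have conv (e : R) : 0 < e -> exists N, forall n, (N <= n)%N ->
    E_class w (A_ n - A) /\ E_norm w (A_ n - A) <= e.
  move=> e0; have [N hN] := cauchyA e e0; exists N => n Nn.
  have cAn : compact_operator (A_ n - A).
    rewrite -scaleN1r; apply: compact_operator_add; first exact: (EA n).1.
    exact: compact_operator_scale.
  apply: E_intro => //; first exact: ltW.
  move=> k; apply: gelfand_le_mono (leqnn k) _ (singular_value_gelfand k cAn).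
  apply/ler_addgt0Pr => d d0; apply: singular_value_le => //.
    by rewrite addr_ge0 ?mulr_ge0 // ltW.
  have w1 : 0 < w 0%N + 1 by rewrite ltr_wpDl.
  have [N' hN'] := unif _ (divr_gt0 d0 w1); pose m := maxn N N'.
  have -> : A_ n - A = (A_ n - A_ m) + (A_ m - A) by rewrite addrA subrK.
  (* All k functionals go to A_n - A_m; A_m - A is small in operator norm and gets none. *)
  rewrite -[k]addn0; apply: gelfand_le_add.
    rewrite addn0; apply: gelfand_le_mono (leqnn k) _
      (E_norm_gelfand (E_sub (EA n) (EA m)) k).
    by rewrite ler_wpM2r // ltW // hN // leq_maxl.
  apply/gelfand_le_bound => x; apply: le_trans (hN' m (leq_maxr _ _) x) _.
  rewrite mulrA ler_wpM2r ?rnorm_ge0 // mulrAC ler_pdivrMr //.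
  by rewrite ler_wpM2l ?lerDl // ltW.
have [N /(_ _ (leqnn N)) [EN _]] := conv 1 ltr01.
(* A = A_N - (A_N - A) is a difference of two members of the class. *)
exists A; first by rewrite -(subKr (A_ N) A); exact: E_sub.
apply/cvgrPdist_le => e e0; have [N' hN'] := conv e e0.
exists N' => // n /hN'[En le_e]; rewrite sub0r normrN ger0_norm //.
exact: E_norm_ge0.
Qed.

Lemma E_unnormalised_ideal :
  unnormalised_quasi_Banach_ideal (E_class w) (E_norm w).
Proof.
split.
- by move=> H1 H2 A [cA _]; exact: compact_operator_bounded.
- exact: E_norm_ge0.
- by move=> H1 H2; exact: (E_zero H1 H2).1.
- by move=> H1 H2 A B EA EB; exact: (E_add EA EB).1.
- by move=> H1 H2 c A EA; exact: (E_scale_le c EA).1.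
- move=> H1 H2 A EA; split=> [A0|->]; last exact: (E_zero H1 H2).2.
  apply/funext => x; apply/rnorm_eq0/eqP; rewrite eq_le rnorm_ge0 andbT.
  by have := E_norm_bound EA x; rewrite A0 !mul0r.
- exact: E_norm_scale.
(* The bound [hK] at index 0 gives K >= 1 unless w vanishes identically; the maximum covers that
   case. *)
- exists (Num.max 1 K) => [|H1 H2 A B EA EB]; first by rewrite le_max lexx.
  apply: le_trans (E_add EA EB).2 _.
  by rewrite ler_wpM2r ?addr_ge0 ?E_norm_ge0 // le_max lexx orbT.
- exact: E_comp.
- exact: E_complete.
Qed.

End Add.

End Ideal.

(** * Normalisation at the identity of C *)

Lemma unnormalised_ideal_scale (R : realType) (F : operator_family R)
    (alpha : operator_functional R) (c : R) : 0 < c ->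
  unnormalised_quasi_Banach_ideal F alpha ->
  unnormalised_quasi_Banach_ideal F (fun H1 H2 A => c * alpha H1 H2 A).
Proof.
move=> c0 [bnd ge0 zero add scale eq0 normZ [M M1 normD] comp compl]; split => //.
- by move=> H1 H2 A FA; rewrite mulr_ge0 ?ge0 // ltW.
- move=> H1 H2 A FA; rewrite -(eq0 _ _ _ FA); split=> [/eqP|->].
    by rewrite mulf_eq0 gt_eqF //= => /eqP.
  by rewrite mulr0.
- by move=> H1 H2 a A FA; rewrite normZ // mulrCA.
- exists M => // H1 H2 A B FA FB.
  by rewrite -mulrDr mulrCA ler_pM2l // normD.
- move=> H1 H2 H3 H4 B A C bB FA bC; have [FBAC le] := comp _ _ _ _ _ _ _ bB FA bC.
  by split=> //; rewrite mulrCA -mulrA ler_pM2l.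
move=> H1 H2 A_ FA cauchyA; have [e e0|A FAl Al] := compl _ _ _ FA.
  have [N hN] := cauchyA _ (mulr_gt0 c0 e0); exists N => m n Nm Nn.
  by have := hN m n Nm Nn; rewrite ltr_pM2l.
by exists A => //; rewrite -(mulr0 c); exact: cvgMr.
Qed.

(** The quasi-norm of the identity of C is the inverse of [w 0], so it is 1 as it stands when [w 0]
    is 1, and after multiplication by [w 0] whenever [w 0] is positive. The remaining axioms hold in
    every case, including w = 0, where the class contains zero operators only. *)
Theorem proposition3p15 (R : realType) (w : nat -> R)
    (hw : weight w) (hdot : weight_equiv (dot_weight w) w) :
  [/\ w 0%N = 1 -> quasi_Banach_ideal (E_class w) (E_norm w),
      0 < w 0%N ->
        quasi_Banach_ideal (E_class w) (fun H1 H2 A => w 0%N * E_norm w A)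
    & unnormalised_quasi_Banach_ideal (E_class w) (E_norm w)].
Proof.
have [[K K0 hK] _] := hdot; have ideal := E_unnormalised_ideal hw K0 hK.
split=> // [w1|w0].
  have [|EI nI] := complex_id_E hw; first by rewrite w1.
  by split=> //; rewrite -nI w1 mul1r.
have [EI nI] := complex_id_E hw w0.
by split=> //; exact: unnormalised_ideal_scale.
Qed.
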